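(* For every sequent calculus proof of $\vdash A_1,A_2,\dots,A_n$ in $\mathsf{MLL}^-$ there is a proof of $A_1\wp A_2\wp\cdots\wp A_n$ in the calculus of structures yielding the same proof net, and vice versa.
   Context: $\mathsf{MLL}^-$ formulas: over atoms $a,a^\perp$, $F ::= a\mid a^\perp\mid F\wp F\mid F\otimes F$ ($\wp$ = par, $\otimes$ = tensor), negation $a^{\perp\perp}=a$, $(A\otimes B)^\perp=B^\perp\wp A^\perp$, $(A\wp B)^\perp=B^\perp\otimes A^\perp$ (negation mirrors the formula tree). Sequent calculus (sequents = finite lists): (id) $\vdash A^\perp,A$; (exch) $\vdash\Gamma,A,B,\Delta$ / $\vdash\Gamma,B,A,\Delta$; ($\wp$) $\vdash\Gamma,A,B,\Delta$ / $\vdash\Gamma,A\wp B,\Delta$; ($\otimes$) $\vdash\Gamma,A$ and $\vdash B,\Delta$ / $\vdash\Gamma,A\otimes B,\Delta$; (cut) $\vdash\Gamma,A$ and $\vdash A^\perp,\Delta$ / $\vdash\Gamma,\Delta$. Calculus of structures ($S\{\;\}$ a one-hole formula context; premise $\Rightarrow$ conclusion): $\mathsf{i}{\downarrow}$: $\Rightarrow A^\perp\wp A$ and $S\{B\}\Rightarrow S\{(A^\perp\wp A)\otimes B\}$; $\mathsf{i}{\uparrow}$: $A\otimes A^\perp\Rightarrow$ and $S\{B\wp(A\otimes A^\perp)\}\Rightarrow S\{B\}$; $\mathsf{com}{\downarrow}$: $S\{A\wp B\}\Rightarrow S\{B\wp A\}$; $\mathsf{com}{\uparrow}$: $S\{A\otimes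 B\}\Rightarrow S\{B\otimes A\}$; $\mathsf{ass}{\downarrow}$: $S\{A\wp(B\wp C)\}\Rightarrow S\{(A\wp B)\wp C\}$; $\mathsf{ass}{\uparrow}$: $S\{A\otimes(B\otimes C)\}\Rightarrow S\{(A\otimes B)\otimes C\}$; $\mathsf{s}$: $S\{A\otimes(B\wp C)\}\Rightarrow S\{(A\otimes B)\wp C\}$; a proof starts with a premise-free $\mathsf{i}{\downarrow}$. Proof nets: a pre-proof net is a list of formula trees, finitely many cuts (trees with root $A\oslash A^\perp$), and a perfect matching of leaves pairing $a$-occurrences with $a^\perp$-occurrences. The proof net of a sequent calculus proof of $\vdash A_1,\dots,A_n$: conclusions $A_1,\dots,A_n$, one cut $A\oslash A^\perp$ per cut instance on $A$, and two leaves linked iff, traced upward through the proof, they stem from the same identity instance $\vdash B^\perp,B$ at mirror positions of $B^\perp$ and $B$. The proof net of a calculus-of-structures proof of $A_1\wp\cdots\wp A_n$: conclusions $A_1,\dots,A_n$ (the outermost $\wp$'s read as commas), one cut $A\oslash A^\perp$ per instance of $\mathsf{i}{\uparrow}$ removing $A\otimes A^\perp$, and two leaves linked iff, traced upward through the derivation, they stem from the same instance of $\mathsf{i}{\downarrow}$ introducing $B^\perp\wp B$ at mirror positions. *)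

(* Defs.v *)
From HB Require Import structures.
From mathcomp Require Import all_boot.
Set Implicit Arguments.
Unset Strict Implicit.
Unset Printing Implicit Defensive.

(** * Formulas *)

Inductive formula (V : Type) : Type :=
| Pos of V
| Neg of V
| Par of formula V & formula V
| Tens of formula V & formula V.

Declare Scope mll_scope.
Delimit Scope mll_scope with mll.
Local Open Scope mll_scope.
Notation "A ⅋ B" := (Par A B) (at level 50, left associativity) : mll_scope.
Notation "A ⊗ B" := (Tens A B) (at level 40, left associativity) : mll_scope.

Fixpoint dual V (A : formula V) : formula V :=
  match A with
  | Pos a => Neg a
  | Neg a => Pos a
  | B ⅋ C => dual C ⊗ dual B
  | B ⊗ C => dual C ⅋ dual B
  end.
Notation "A ^⊥" := (dual A) (at level 2, format "A ^⊥") : mll_scope.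

(** Nodes of a formula tree are addressed by paths from the root, [false]
    meaning left and [true] meaning right.  [leaf_at A p] is the literal at the
    leaf [p] of [A] (with [true] for [a] and [false] for its negation), and
    [None] when [p] does not lead to a leaf. *)
Definition path := seq bool.

Fixpoint leaf_at V (A : formula V) (p : path) : option (V * bool) :=
  match A, p with
  | Pos a, [::] => Some (a, true)
  | Neg a, [::] => Some (a, false)
  | B ⅋ C, d :: q | B ⊗ C, d :: q => leaf_at (if d then C else B) q
  | _, _ => None
  end.

(** Since negation reverses the formula tree, the leaf of [A^⊥] at the mirror
    position of the leaf [p] of [A] is [mirror p] (see [leaf_at_dual]). *)
Definition mirror (p : path) : path := map negb p.

(** * Pre-proof nets *)

(** The trees of a net are [inl i], the [i]-th conclusion, and [inr c], the cut
    indexed by [c]. *)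
Definition node (I : Type) : Type := ((nat + I) * path)%type.

(** The cut [c] is the tree [A ⊘ A^⊥] with [A := cut_formula c]: the paths into
    it start with [false] on the side of [A] and with [true] on that of [A^⊥].
    The cuts come with no order, being indexed by a finite type. *)
Record linked_forest (V : Type) : Type := LinkedForest {
  concl : seq (formula V);
  cut : finType;
  cut_formula : cut -> formula V;
  link : node cut -> node cut -> Prop }.

Definition literal_of V (G : seq (formula V)) (I : Type) (cf : I -> formula V)
    (x : node I) : option (V * bool) :=
  match x with
  | (inl i, p) => obind (fun A => leaf_at A p) (onth G i)
  | (inr c, d :: p) => leaf_at (if d then (cf c)^⊥ else cf c) p
  | (inr c, [::]) => None
  end.

Definition perfect_matching V (X : Type) (lit : X -> option (V * bool))
    (R : X -> X -> Prop) : Prop :=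
  [/\ forall x y, R x y -> R y x,
      forall x y, R x y ->
        exists a b, lit x = Some (a, b) /\ lit y = Some (a, ~~ b)
    & forall x, lit x <> None -> exists! y, R x y].

Definition preproof_net V (N : linked_forest V) : Prop :=
  perfect_matching (literal_of (concl N) (@cut_formula V N)) (@link V N).

Definition rename_cut I J (f : I -> J) (x : node I) : node J :=
  match x with
  | (inl i, p) => (inl i, p)
  | (inr c, p) => (inr (f c), p)
  end.

(** Equality of nets, up to the names of the cuts. *)
Definition same_net V (N M : linked_forest V) : Prop :=
  concl N = concl M /\
  exists f : cut N -> cut M,
    [/\ bijective f,
        forall c, cut_formula (f c) = cut_formula c
      & forall x y, link x y <-> link (rename_cut f x) (rename_cut f y)].

(** The nets of proofs are computed from the premises to the conclusion: every
    rule sends the leaves of its premises to leaves of the new net, so that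
    [push f R] is the linking [R] of a premise seen in the new net. *)
Definition push X Y (f : X -> Y) (R : X -> X -> Prop) (x y : Y) : Prop :=
  exists u v, [/\ R u v, x = f u & y = f v].

Definition union_link X (R1 R2 : X -> X -> Prop) (x y : X) :
    Prop :=
  R1 x y \/ R2 x y.

(** The links created by an identity on [A], where [f] and [g] locate the leaves
    of [A^⊥] and those of [A]. *)
Definition axiom_link V (A : formula V) X (f g : path -> X) (x y : X) : Prop :=
  exists2 p, leaf_at A p <> None &
    (x = f (mirror p) /\ y = g p) \/ (x = g p /\ y = f (mirror p)).

(** * The sequent calculus *)

Inductive sc_proof (V : Type) : seq (formula V) -> Type :=
| sc_id A : sc_proof [:: A^⊥; A]
| sc_exch G A B D :
    sc_proof (G ++ [:: A, B & D]) -> sc_proof (G ++ [:: B, A & D])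
| sc_par G A B D :
    sc_proof (G ++ [:: A, B & D]) -> sc_proof (G ++ A ⅋ B :: D)
| sc_tens G A B D :
    sc_proof (G ++ [:: A]) -> sc_proof (B :: D) -> sc_proof (G ++ A ⊗ B :: D)
| sc_cut G A D :
    sc_proof (G ++ [:: A]) -> sc_proof (A^⊥ :: D) -> sc_proof (G ++ D).

(** In the following functions [n] is the size of the context [G] of the rule;
    [n] and [n.+1] are thus the indices of the active formulas in the premise of
    an exchange or a par, [n] that of the active formula in the left premise of
    a tensor or a cut, and [0] that of the one in the right premise. *)
Definition exch_node I (n : nat) (x : node I) : node I :=
  match x with
  | (inl i, p) =>
      (inl (if i == n then n.+1 else if i == n.+1 then n else i), p)
  | (inr c, p) => (inr c, p)
  end.

Definition par_node I (n : nat) (x : node I) : node I :=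
  match x with
  | (inl i, p) =>
      if i < n then (inl i, p)
      else if i == n then (inl n, false :: p)
      else if i == n.+1 then (inl n, true :: p)
      else (inl i.-1, p)
  | (inr c, p) => (inr c, p)
  end.

Definition tens_node_l I J (n : nat) (x : node I) : node (I + J) :=
  match x with
  | (inl i, p) => (inl i, if i == n then false :: p else p)
  | (inr c, p) => (inr (inl c), p)
  end.

Definition tens_node_r I J (n : nat) (x : node J) : node (I + J) :=
  match x with
  | (inl i, p) => (inl (n + i), if i == 0 then true :: p else p)
  | (inr c, p) => (inr (inr c), p)
  end.

(** The new cut has index [None]. *)
Definition cut_node_l I J (n : nat) (x : node I) : node (option (I + J)) :=
  match x with
  | (inl i, p) => if i == n then (inr None, false :: p) else (inl i, p)
  | (inr c, p) => (inr (Some (inl c)), p)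
  end.

Definition cut_node_r I J (n : nat) (x : node J) : node (option (I + J)) :=
  match x with
  | (inl i, p) =>
      if i is j.+1 then (inl (n + j), p) else (inr None, true :: p)
  | (inr c, p) => (inr (Some (inr c)), p)
  end.

Definition sum_cut V I J (f : I -> formula V) (g : J -> formula V)
    (c : I + J) : formula V :=
  match c with inl i => f i | inr j => g j end.

Definition new_cut V I (A : formula V) (f : I -> formula V)
    (c : option I) : formula V :=
  if c is Some i then f i else A.

Fixpoint sc_net V (G : seq (formula V)) (pi : sc_proof G) : linked_forest V :=
  match pi with
  | sc_id A =>
      @LinkedForest V [:: A^⊥; A] void (of_void _)
        (axiom_link A (fun p => (inl 0, p)) (fun p => (inl 1, p)))
  | sc_exch G A B D pi1 =>
      let N := sc_net pi1 in
      @LinkedForest V (G ++ [:: B, A & D]) (cut N) (@cut_formula V N)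
        (push (exch_node (size G)) (@link V N))
  | sc_par G A B D pi1 =>
      let N := sc_net pi1 in
      @LinkedForest V (G ++ A ⅋ B :: D) (cut N) (@cut_formula V N)
        (push (par_node (size G)) (@link V N))
  | sc_tens G A B D pi1 pi2 =>
      let N := sc_net pi1 in
      let M := sc_net pi2 in
      @LinkedForest V (G ++ A ⊗ B :: D) (cut N + cut M)%type
        (sum_cut (@cut_formula V N) (@cut_formula V M))
        (union_link (push (@tens_node_l _ _ (size G)) (@link V N))
                    (push (@tens_node_r _ _ (size G)) (@link V M)))
  | sc_cut G A D pi1 pi2 =>
      let N := sc_net pi1 in
      let M := sc_net pi2 in
      @LinkedForest V (G ++ D) (option (cut N + cut M))
        (new_cut A (sum_cut (@cut_formula V N) (@cut_formula V M)))
        (union_link (push (@cut_node_l _ _ (size G)) (@link V N))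
                    (push (@cut_node_r _ _ (size G)) (@link V M)))
  end.

(** * The calculus of structures *)

Inductive context (V : Type) : Type :=
| Hole
| ParL of context V & formula V
| ParR of formula V & context V
| TensL of context V & formula V
| TensR of formula V & context V.
Arguments Hole {V}.

Fixpoint fill V (K : context V) (A : formula V) : formula V :=
  match K with
  | Hole => A
  | ParL K' B => fill K' A ⅋ B
  | ParR B K' => B ⅋ fill K' A
  | TensL K' B => fill K' A ⊗ B
  | TensR B K' => B ⊗ fill K' A
  end.

Fixpoint hole_path V (K : context V) : path :=
  match K with
  | Hole => [::]
  | ParL K' _ | TensL K' _ => false :: hole_path K'
  | ParR _ K' | TensR _ K' => true :: hole_path K'
  end.

(** The rules that neither create nor delete leaves, from premise to conclusion
    and outside of any context. *)
Inductive shuffle (V : Type) : formula V -> formula V -> Type :=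
| com_down A B : shuffle (A ⅋ B) (B ⅋ A)
| com_up A B : shuffle (A ⊗ B) (B ⊗ A)
| ass_down A B C : shuffle (A ⅋ (B ⅋ C)) ((A ⅋ B) ⅋ C)
| ass_up A B C : shuffle (A ⊗ (B ⊗ C)) ((A ⊗ B) ⊗ C)
| switch A B C : shuffle (A ⊗ (B ⅋ C)) ((A ⊗ B) ⅋ C).

Definition swap_path (p : path) : path :=
  if p is d :: q then ~~ d :: q else p.

Definition rotate_path (p : path) : path :=
  match p with
  | false :: q => [:: false, false & q]
  | true :: false :: q => [:: false, true & q]
  | true :: true :: q => true :: q
  | _ => p
  end.

Definition shuffle_path V (A B : formula V) (r : shuffle A B) : path -> path :=
  match r with
  | com_down _ _ | com_up _ _ => swap_path
  | ass_down _ _ _ | ass_up _ _ _ | switch _ _ _ => rotate_path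
  end.

(** [cs_proof (Some A)] is the type of the proofs of [A]; [None] stands for the
    empty conclusion of the context-free instances of [i↑]. *)
Inductive cs_proof (V : Type) : option (formula V) -> Type :=
| cs_axiom A : cs_proof (Some (A^⊥ ⅋ A))
| cs_idown K A B :
    cs_proof (Some (fill K B)) -> cs_proof (Some (fill K ((A^⊥ ⅋ A) ⊗ B)))
| cs_refute A : cs_proof (Some (A ⊗ A^⊥)) -> cs_proof None
| cs_iup K A B :
    cs_proof (Some (fill K (B ⅋ (A ⊗ A^⊥)))) -> cs_proof (Some (fill K B))
| cs_shuffle K A B (r : shuffle A B) :
    cs_proof (Some (fill K A)) -> cs_proof (Some (fill K B)).

(** In the following functions [h] is the path to the hole of the context. *)
Definition under (h : path) (f : path -> path) (p : path) : path :=
  if prefix h p then h ++ f (drop (size h) p) else p.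

Definition deep_node I (h : path) (f : path -> path) (x : node I) : node I :=
  match x with
  | (inl i, p) => (inl i, under h f p)
  | (inr c, p) => (inr c, p)
  end.

Definition refute_node I (x : node I) : node (option I) :=
  match x with
  | (inl i, p) => (inr None, p)
  | (inr c, p) => (inr (Some c), p)
  end.

Definition iup_node I (h : path) (x : node I) : node (option I) :=
  match x with
  | (inl i, p) =>
      if prefix (rcons h true) p then (inr None, drop (size h).+1 p)
      else if prefix (rcons h false) p then (inl i, h ++ drop (size h).+1 p)
      else (inl i, p)
  | (inr c, p) => (inr (Some c), p)
  end.

Fixpoint cs_net1 V (C : option (formula V)) (d : cs_proof C) :
    linked_forest V :=
  match d with
  | cs_axiom A =>
      @LinkedForest V [:: A^⊥ ⅋ A] void (of_void _)
        (axiom_link A (fun p => (inl 0, false :: p))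
                      (fun p => (inl 0, true :: p)))
  | cs_idown K A B d1 =>
      let N := cs_net1 d1 in
      let h := hole_path K in
      @LinkedForest V [:: fill K ((A^⊥ ⅋ A) ⊗ B)] (cut N) (@cut_formula V N)
        (union_link (push (deep_node h (cons true)) (@link V N))
           (axiom_link A (fun p => (inl 0, h ++ [:: false, false & p]))
                         (fun p => (inl 0, h ++ [:: false, true & p]))))
  | cs_refute A d1 =>
      let N := cs_net1 d1 in
      @LinkedForest V [::] (option (cut N)) (new_cut A (@cut_formula V N))
        (push (@refute_node _) (@link V N))
  | cs_iup K A B d1 =>
      let N := cs_net1 d1 in
      @LinkedForest V [:: fill K B] (option (cut N))
        (new_cut A (@cut_formula V N))
        (push (iup_node (hole_path K)) (@link V N))
  | cs_shuffle K A B r d1 =>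
      let N := cs_net1 d1 in
      @LinkedForest V [:: fill K B] (cut N) (@cut_formula V N)
        (push (deep_node (hole_path K) (shuffle_path r)) (@link V N))
  end.

(** [cs_net1] yields a net with the proved formula as its only conclusion.  To
    read the outermost pars of [A_1 ⅋ ... ⅋ A_n] as commas one has to say which
    ones these are, some [A_i] being possibly pars themselves: a bracketing is a
    formula of this form, with its outermost pars marked. *)
Inductive bracketing (V : Type) : Type :=
| Single of formula V
| Comma of bracketing V & bracketing V.

Fixpoint fringe V (T : bracketing V) : seq (formula V) :=
  match T with
  | Single A => [:: A]
  | Comma T1 T2 => fringe T1 ++ fringe T2
  end.

Fixpoint big_par V (T : bracketing V) : formula V :=
  match T with
  | Single A => A
  | Comma T1 T2 => big_par T1 ⅋ big_par T2
  end.

(** The conclusion, and the path in it, to which a path to a leaf of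
    [big_par T] leads. *)
Fixpoint split_path V (T : bracketing V) (p : path) : nat * path :=
  match T, p with
  | Single _, _ => (0, p)
  | Comma T1 _, false :: q => split_path T1 q
  | Comma T1 T2, true :: q =>
      let: (i, q') := split_path T2 q in (size (fringe T1) + i, q')
  | Comma _ _, [::] => (0, p)
  end.

Definition split_node V (T : bracketing V) I (x : node I) : node I :=
  match x with
  | (inl _, p) => let: (j, q) := split_path T p in (inl j, q)
  | (inr c, p) => (inr c, p)
  end.

Definition cs_net V (T : bracketing V) (d : cs_proof (Some (big_par T))) :
    linked_forest V :=
  let N := cs_net1 d in
  @LinkedForest V (fringe T) (cut N) (@cut_formula V N)
    (push (@split_node V T _) (@link V N)).

(** * The nets of proofs are pre-proof nets *)

Lemma dualK V (A : formula V) : A^⊥^⊥ = A.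
Proof. by elim: A => //= A -> B ->. Qed.

Lemma leaf_at_dual V (A : formula V) (p : path) :
  leaf_at A^⊥ (mirror p) = omap (fun l => (l.1, ~~ l.2)) (leaf_at A p).
Proof.
by elim: A p => [a|a|A IHA B IHB|A IHA B IHB] [|[] p] //=; rewrite ?IHA ?IHB.
Qed.

Lemma mirrorK : involutive mirror.
Proof. by elim=> //= b p ->; rewrite negbK. Qed.

Section Transport.
Variables (V X1 X2 X : Type).
Variables (l1 : X1 -> option (V * bool)) (l2 : X2 -> option (V * bool)).
Variables (l : X -> option (V * bool)) (R1 : X1 -> X1 -> Prop).
Variables (R2 : X2 -> X2 -> Prop) (f1 : X1 -> X) (f2 : X2 -> X).
Variable (g : X -> X1 + X2).

(** [g] inverts [f1] and [f2] on leaves. *)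
Lemma matching_union :
  perfect_matching l1 R1 -> perfect_matching l2 R2 ->
  (forall x, l1 x <> None -> l (f1 x) = l1 x /\ g (f1 x) = inl x) ->
  (forall x, l2 x <> None -> l (f2 x) = l2 x /\ g (f2 x) = inr x) ->
  (forall z, l z <> None ->
     match g z with
     | inl x => f1 x = z /\ l1 x <> None
     | inr x => f2 x = z /\ l2 x <> None
     end) ->
  perfect_matching l (union_link (push f1 R1) (push f2 R2)).
Proof.
move=> [s1 d1 u1] [s2 d2 u2] h1 h2 hg.
have e1 x y : R1 x y -> l1 x <> None /\ l1 y <> None.
  by move=> /d1 [a [b [-> ->]]].
have e2 x y : R2 x y -> l2 x <> None /\ l2 y <> None.
  by move=> /d2 [a [b [-> ->]]].
split.
- move=> x y [] [u [v [Ruv -> ->]]]; [left|right]; exists v, u; split=> //.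
    exact: s1.
  exact: s2.
- move=> x y [] [u [v [Ruv -> ->]]].
    have [lu lv] := e1 _ _ Ruv.
    by rewrite (h1 _ lu).1 (h1 _ lv).1; apply: d1.
  have [lu lv] := e2 _ _ Ruv.
  by rewrite (h2 _ lu).1 (h2 _ lv).1; apply: d2.
- move=> z /[dup] lz /hg; case gz: (g z) => [x|x] [fx lx].
    have [y [Rxy uy]] := u1 _ lx; exists (f1 y); split.
      by left; exists x, y.
    move=> w [] [u [v [Ruv zu ->]]].
      have [lu lv] := e1 _ _ Ruv.
      have := (h1 _ lu).2; rewrite -zu gz => -[xu].
      by rewrite -xu in Ruv; rewrite (uy _ Ruv).
    have [lu lv] := e2 _ _ Ruv.
    by have := (h2 _ lu).2; rewrite -zu gz.
  have [y [Rxy uy]] := u2 _ lx; exists (f2 y); split.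
    by right; exists x, y.
  move=> w [] [u [v [Ruv zu ->]]].
    have [lu lv] := e1 _ _ Ruv.
    by have := (h1 _ lu).2; rewrite -zu gz.
  have [lu lv] := e2 _ _ Ruv.
  have := (h2 _ lu).2; rewrite -zu gz => -[xu].
  by rewrite -xu in Ruv; rewrite (uy _ Ruv).
Qed.

End Transport.

Lemma matching_ext V X (l : X -> option (V * bool)) (R S : X -> X -> Prop) :
  (forall x y, R x y <-> S x y) ->
  perfect_matching l R -> perfect_matching l S.
Proof.
move=> RS [s d u]; split.
- by move=> x y /RS /s /RS.
- by move=> x y /RS /d.
- move=> x /u [y [Rxy uy]]; exists y; split; first exact/RS.
  by move=> z /RS /uy.
Qed.

Lemma matching_push V X1 X (l1 : X1 -> option (V * bool)) l R1
    (f1 : X1 -> X) (g : X -> X1) :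
  perfect_matching l1 R1 ->
  (forall x, l1 x <> None -> l (f1 x) = l1 x /\ g (f1 x) = x) ->
  (forall z, l z <> None -> f1 (g z) = z /\ l1 (g z) <> None) ->
  perfect_matching l (push f1 R1).
Proof.
move=> m h hg.
apply: (@matching_ext _ _ _
  (union_link (push f1 R1) (push (of_void X) (fun _ _ => False)))).
  move=> x y; split; last by left.
  by case=> // -[[]].
apply: (@matching_union _ _ _ _ _ (fun=> None) _ _ _ _ _ (fun z => inl (g z))).
- exact: m.
- by split.
- by move=> x /h [-> ->].
- by [].
- by move=> z /hg.
Qed.

Definition axiom_literal V (A : formula V) (x : bool * path) :=
  leaf_at (if x.1 then A else A^⊥) x.2.

Lemma axiom_matching V (A : formula V) :
  perfect_matching (axiom_literal A)
    (axiom_link A (fun p => (false, p)) (fun p => (true, p))).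
Proof.
split.
- move=> x y [p lp [[-> ->]|[-> ->]]]; exists p => //; [by right|by left].
- move=> x y [p lp [[-> ->]|[-> ->]]]; rewrite /axiom_literal /= leaf_at_dual;
  case: (leaf_at A p) lp => // -[a b] _; exists a.
    by exists (~~ b); rewrite negbK.
  by exists b.
- case=> -[] p; rewrite /axiom_literal /=.
    move=> lp; exists (false, mirror p); split; first by exists p => //; right.
    by move=> y [q lq [[[]]|[[->] ->]]].
  rewrite -{1}[p]mirrorK leaf_at_dual => lp.
  have lp' : leaf_at A (mirror p) <> None by move: lp; case: leaf_at.
  exists (true, mirror p); split.
    by exists (mirror p) => //; left; rewrite mirrorK.
  by move=> y [q lq [[[->] ->]|[[]]]] //; rewrite mirrorK.
Qed.

Lemma push_axiom V (A : formula V) X (f g : path -> X) x y :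
  push (fun z : bool * path => if z.1 then g z.2 else f z.2)
    (axiom_link A (fun p => (false, p)) (fun p => (true, p))) x y
  <-> axiom_link A f g x y.
Proof.
split.
  by move=> [u [v [[p lp [[-> ->]|[-> ->]]] -> ->]]]; exists p => //=;
    [left|right].
move=> [p lp [[-> ->]|[-> ->]]].
  by exists (false, mirror p), (true, p); split=> //; exists p => //; left.
by exists (true, p), (false, mirror p); split=> //; exists p => //; right.
Qed.

Local Arguments onth {T} !s !n : simpl nomatch.

Lemma onth_size V (G D : seq (formula V)) i :
  onth (G ++ D) (size G + i) = onth D i.
Proof. by rewrite onth_cat -ltn_subRL subnn ltn0 addKn. Qed.

Lemma onth_mid V (G D : seq (formula V)) A : onth (G ++ A :: D) (size G) = Some A.
Proof. by rewrite -{1}[size G]addn0 onth_size. Qed.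

Lemma onth_mid1 V (G D : seq (formula V)) A B :
  onth (G ++ [:: A, B & D]) (size G).+1 = Some B.
Proof. by rewrite -addn1 onth_size. Qed.

Lemma onth_lt V (G D : seq (formula V)) i :
  i < size G -> onth (G ++ D) i = onth G i.
Proof. by rewrite onth_cat => ->. Qed.

Variant split_spec (n : nat) : nat -> Prop :=
| SplitLt i of i < n : split_spec n i
| SplitGe i : split_spec n (n + i).

Lemma split_indexP n i : split_spec n i.
Proof.
case: (ltnP i n) => h; first exact: SplitLt.
by rewrite -(subnKC h); apply: SplitGe.
Qed.

Lemma shiftE n j :
  [/\ (n + j < n) = false, (n + j == n) = (j == 0)
    & (n + j == n.+1) = (j == 1)].
Proof.
split; first by rewrite ltnNge leq_addr.
  by rewrite -{2}[n]addn0 eqn_add2l.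
by rewrite -addn1 eqn_add2l.
Qed.

Lemma belowE n i : i < n ->
  [/\ (i < n) = true, (i == n) = false & (i == n.+1) = false].
Proof.
move=> lt_in; split=> //; first exact: ltn_eqF.
by apply: ltn_eqF; apply: ltnW.
Qed.

Ltac split_index n i :=
  case: (split_indexP n i) => {}i;
  [move=> /belowE; case=> lt_in neq neq' | have [lt_in neq neq'] := shiftE n i].

Lemma exch_matching V (I : Type) (cf : I -> formula V) G A B D R :
  perfect_matching (literal_of (G ++ [:: A, B & D]) cf) R ->
  perfect_matching (literal_of (G ++ [:: B, A & D]) cf)
    (push (exch_node (size G)) R).
Proof.
have key C C' (x : node I) (n := size G) :
    literal_of (G ++ [:: C', C & D]) cf (exch_node n x) =
      literal_of (G ++ [:: C, C' & D]) cf x /\ exch_node n (exch_node n x) = x.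
  case: x => -[i|c] p; last by split.
  rewrite /exch_node; split_index n i.
    rewrite neq neq' /= neq neq'; split=> //.
    by rewrite !onth_lt.
  rewrite !neq neq'; case: i neq neq' lt_in => [|[|i]] neq neq' lt_in.
  - have [_ neq1 neq1'] := shiftE n 1.
    rewrite -addn1 eqxx neq1 !addn0 eqxx. split=> //=.
    by rewrite onth_mid onth_size.
  - split; last by rewrite /= eqxx addn1.
    by rewrite /= -{1}[n]addn0 !onth_size.
  - by rewrite /= !onth_size neq neq'.
move=> m; apply: (matching_push (g := @exch_node I (size G)) m) => [x _|z lz].
  by have [-> ->] := key A B x.
by have [-> ->] := key B A z.
Qed.

Definition unpar_node I (n : nat) (x : node I) : node I :=
  match x with
  | (inl i, p) =>
      if i < n then (inl i, p)
      else if i == n then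
        if p is d :: q then (inl (if d then n.+1 else n), q) else (inl n, p)
      else (inl i.+1, p)
  | (inr c, p) => (inr c, p)
  end.

Lemma par_matching V (I : Type) (cf : I -> formula V) G A B D R :
  perfect_matching (literal_of (G ++ [:: A, B & D]) cf) R ->
  perfect_matching (literal_of (G ++ A ⅋ B :: D) cf)
    (push (par_node (size G)) R).
Proof.
set n := size G => m.
apply: (matching_push (g := @unpar_node I n) m) => [] [[i|c] p] //=.
  split_index n i; rewrite lt_in ?neq ?neq'.
    by rewrite /= !onth_lt // lt_in.
  rewrite onth_size; case: i lt_in neq neq' => [|[|i]] lt_in neq neq' //= lp.
  - by rewrite onth_mid ltnn eqxx addn0.
  - by rewrite onth_mid ltnn eqxx addn1.
  - have [h0 h1 _] := shiftE n i.+1.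
    by rewrite addnS /= h0 h1 onth_size -addnS.
split_index n i; rewrite lt_in ?neq.
  by rewrite /= !onth_lt // ?lt_in ?neq ?neq'.
rewrite onth_size; case: i lt_in neq neq' => [|i] lt_in neq neq' //= lp.
  case: p lp => // -[] q lq /=.
    rewrite ltnNge leqnSn (gtn_eqF (ltnSn n)) eqxx addn0.
    by rewrite onth_mid1.
  by rewrite ltnn eqxx addn0 onth_mid.
have [h0 h1 h2] := shiftE n i.+2.
by rewrite -addnS h0 h1 h2 onth_size /= addnS.
Qed.

Definition untens_node I J (n : nat) (x : node (I + J)) : node I + node J :=
  match x with
  | (inl i, p) =>
      if i < n then inl (inl i, p)
      else if i == n then
        if p is d :: q then if d then inr (inl 0, q) else inl (inl n, q)
        else inl (inl n, p)
      else inr (inl (i - n), p)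
  | (inr (inl c), p) => inl (inr c, p)
  | (inr (inr c), p) => inr (inr c, p)
  end.

Lemma tens_matching V (I J : Type) (cf : I -> formula V) (cg : J -> formula V)
    G A B D R1 R2 :
  perfect_matching (literal_of (G ++ [:: A]) cf) R1 ->
  perfect_matching (literal_of (B :: D) cg) R2 ->
  perfect_matching (literal_of (G ++ A ⊗ B :: D) (sum_cut cf cg))
    (union_link (push (@tens_node_l _ _ (size G)) R1)
                (push (@tens_node_r _ _ (size G)) R2)).
Proof.
set n := size G => m1 m2.
apply: (matching_union (g := @untens_node I J n) m1 m2).
- move=> [[i|c] p] //=; split_index n i; rewrite ?lt_in ?neq.
    by rewrite !onth_lt.
  rewrite !onth_size; case: i lt_in neq neq' => [|i] lt_in neq neq' //=.
    by rewrite addn0.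
  by rewrite onth0n.
- move=> [[i|c] p] //=; have [h0 h1 h2] := shiftE n i.
  rewrite h0 h1 onth_size; case: i h0 h1 h2 => [|i] _ _ _ //=.
  by rewrite addKn.
- move=> [[i|[c|c]] p] //=; split_index n i; rewrite ?lt_in ?neq.
    by rewrite /= !onth_lt // ?neq.
  rewrite !onth_size; case: i lt_in neq neq' => [|i] lt_in neq neq' //=.
    case: p => [|[] q] //= lq; rewrite addn0 //.
    by rewrite eqxx onth_mid.
  by rewrite addKn.
Qed.

Definition uncut_node I J (n : nat) (x : node (option (I + J))) :
    node I + node J :=
  match x with
  | (inl i, p) => if i < n then inl (inl i, p) else inr (inl (i - n).+1, p)
  | (inr None, d :: q) => if d then inr (inl 0, q) else inl (inl n, q)
  | (inr None, [::]) => inl (inl n, [::])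
  | (inr (Some (inl c)), p) => inl (inr c, p)
  | (inr (Some (inr c)), p) => inr (inr c, p)
  end.

Lemma cut_matching V (I J : Type) (cf : I -> formula V) (cg : J -> formula V)
    G A D R1 R2 :
  perfect_matching (literal_of (G ++ [:: A]) cf) R1 ->
  perfect_matching (literal_of (A^⊥ :: D) cg) R2 ->
  perfect_matching (literal_of (G ++ D) (new_cut A (sum_cut cf cg)))
    (union_link (push (@cut_node_l _ _ (size G)) R1)
                (push (@cut_node_r _ _ (size G)) R2)).
Proof.
set n := size G => m1 m2.
apply: (matching_union (g := @uncut_node I J n) m1 m2).
- move=> [[i|c] p] //=; split_index n i; rewrite ?lt_in ?neq.
    by rewrite /= lt_in !onth_lt.
  rewrite !onth_size; case: i lt_in neq neq' => [|i] lt_in neq neq' //=.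
    by rewrite addn0.
  by rewrite onth0n.
- move=> [[[|i]|c] p] //=; have [h0 h1 h2] := shiftE n i.
  by rewrite h0 onth_size addKn.
- move=> [[i|[[c|c]|]] p] //=.
    split_index n i; rewrite ?lt_in ?neq.
      by rewrite /= !onth_lt // ?neq.
    by rewrite addKn onth_size.
  case: p => [|[] q] //= lq.
  by rewrite eqxx onth_mid.
Qed.

Lemma id_matching V (A : formula V) (cf : void -> formula V) :
  perfect_matching (literal_of [:: A^⊥; A] cf)
    (axiom_link A (fun p => (inl 0, p)) (fun p => (inl 1, p))).
Proof.
apply: (matching_ext (push_axiom _ _ _)).
apply: (@matching_push _ _ _ _ _ _ _
  (fun x => (if x.1 is inl 1 then true else false, x.2))
  (axiom_matching A)).
  by move=> [[] p].
by move=> [[[|[|i]]|[]] p] //=; rewrite onth0n.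
Qed.

Lemma sc_net_preproof V (G : seq (formula V)) (pi : sc_proof G) :
  preproof_net (sc_net pi).
Proof.
rewrite /preproof_net.
have conclE G' (r : sc_proof G') : concl (sc_net r) = G' by case: r.
elim: pi => [A|{}G A B D pi IH|{}G A B D pi IH|{}G A B D pi IH1 rho IH2
            |{}G A D pi IH1 rho IH2] /=.
- exact: id_matching.
- by move: IH; rewrite conclE; apply: exch_matching.
- by move: IH; rewrite conclE; apply: par_matching.
- by move: IH1 IH2; rewrite !conclE; apply: tens_matching.
- by move: IH1 IH2; rewrite !conclE; apply: cut_matching.
Qed.

Lemma leaf_at_hole V (K : context V) A p :
  leaf_at (fill K A) (hole_path K ++ p) = leaf_at A p.
Proof. by elim: K. Qed.

Lemma leaf_at_outside V (K : context V) A B p :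
  ~~ prefix (hole_path K) p -> leaf_at (fill K A) p = leaf_at (fill K B) p.
Proof.
elim: K p => [|K IH F|F K IH|K IH F|F K IH] [|[] p] //=; rewrite ?prefix0s //;
  exact: IH.
Qed.

Variant hole_spec (h : path) : path -> Type :=
| InHole q : hole_spec h (h ++ q)
| OffHole p of ~~ prefix h p : hole_spec h p.

Lemma holeP h p : hole_spec h p.
Proof.
case: (boolP (prefix h p)) => hp; last exact: OffHole.
by rewrite -[p](cat_take_drop (size h)); move: hp; rewrite prefixE => /eqP ->;
  apply: InHole.
Qed.

Lemma under_in h f q : under h f (h ++ q) = h ++ f q.
Proof. by rewrite /under prefix_prefix drop_size_cat. Qed.

Lemma under_off h f p : ~~ prefix h p -> under h f p = p.
Proof. by rewrite /under => /negbTE ->. Qed.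

Definition unrotate_path (p : path) : path :=
  match p with
  | false :: false :: q => false :: q
  | false :: true :: q => [:: true, false & q]
  | true :: q => [:: true, true & q]
  | _ => p
  end.

Definition unshuffle_path V (A B : formula V) (r : shuffle A B) : path -> path :=
  match r with
  | com_down _ _ | com_up _ _ => swap_path
  | ass_down _ _ _ | ass_up _ _ _ | switch _ _ _ => unrotate_path
  end.

Lemma shuffle_pathK V (A B : formula V) (r : shuffle A B) p :
  leaf_at A p <> None ->
  leaf_at B (shuffle_path r p) = leaf_at A p /\
  unshuffle_path r (shuffle_path r p) = p.
Proof. by case: p => [|[] [|[] p]]; case: r. Qed.

Lemma unshuffle_pathK V (A B : formula V) (r : shuffle A B) p :
  leaf_at B p <> None ->
  shuffle_path r (unshuffle_path r p) = p /\
  leaf_at A (unshuffle_path r p) <> None.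
Proof. by case: p => [|[] [|[] p]]; case: r. Qed.

Lemma shuffle_matching V (I : Type) (cf : I -> formula V) K A B
    (r : shuffle A B) R :
  perfect_matching (literal_of [:: fill K A] cf) R ->
  perfect_matching (literal_of [:: fill K B] cf)
    (push (deep_node (hole_path K) (shuffle_path r)) R).
Proof.
set h := hole_path K => m.
have holeE C q : leaf_at (fill K C) (h ++ q) = leaf_at C q := leaf_at_hole K C q.
apply: (matching_push (g := deep_node h (unshuffle_path r)) m);
  move=> [[[|i]|c] p] //=; rewrite ?onth0n //; case: (holeP h p) => {}p.
- rewrite !under_in !holeE => lp.
  by have [-> ->] := shuffle_pathK r lp.
- by move=> hp; rewrite !under_off // (leaf_at_outside A B).
- rewrite !under_in !holeE => lp.
  by have [-> ?] := unshuffle_pathK r lp.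
- by move=> hp; rewrite !under_off // (leaf_at_outside A B).
Qed.

Definition unidown_node I (h : path) (x : node I) : node I + (bool * path) :=
  match x with
  | (inl i, p) =>
      if prefix h p then
        match drop (size h) p with
        | true :: q => inl (inl i, h ++ q)
        | false :: d :: q => inr (d, q)
        | _ => inl x
        end
      else inl x
  | (inr c, p) => inl x
  end.

Lemma idown_matching V (I : Type) (cf : I -> formula V) K A B R :
  let h := hole_path K in
  perfect_matching (literal_of [:: fill K B] cf) R ->
  perfect_matching (literal_of [:: fill K ((A^⊥ ⅋ A) ⊗ B)] cf)
    (union_link (push (deep_node h (cons true)) R)
       (axiom_link A (fun p => (inl 0, h ++ [:: false, false & p]))
                     (fun p => (inl 0, h ++ [:: false, true & p])))).
Proof.
move=> h m.
have holeE C q : leaf_at (fill K C) (h ++ q) = leaf_at C q := leaf_at_hole K C q.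
have e := @push_axiom V A (node I)
  (fun p => (inl 0, h ++ [:: false, false & p]))
  (fun p => (inl 0, h ++ [:: false, true & p])).
pose R' := union_link (push (deep_node h (cons true)) R)
  (push (fun z : bool * path => if z.1 then
      (inl 0, h ++ [:: false, true & z.2]) : node I
    else (inl 0, h ++ [:: false, false & z.2]))
  (axiom_link A (fun p => (false, p)) (fun p => (true, p)))).
apply: (@matching_ext _ _ _ R').
  move=> x y; split=> -[hR|hR]; by [left|right; apply/e].
apply: (matching_union (g := @unidown_node I h) m (axiom_matching A)).
- move=> [[[|i]|c] p] //=; rewrite ?onth0n //; case: (holeP h p) => {}p.
    by rewrite under_in prefix_prefix drop_size_cat // !holeE.
  move=> hp; rewrite under_off // (negbTE hp).
  by rewrite (leaf_at_outside B ((A^⊥ ⅋ A) ⊗ B) hp).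
- by move=> [[] p] /= lp; rewrite holeE prefix_prefix drop_size_cat.
- move=> [[[|i]|c] p] //=; rewrite ?onth0n //; case: (holeP h p) => {}p.
    rewrite prefix_prefix drop_size_cat // holeE.
    by case: p => [|[] [|[] p]] //=; rewrite under_in holeE.
  move=> hp; rewrite (negbTE hp) /= under_off //.
  by rewrite (leaf_at_outside B ((A^⊥ ⅋ A) ⊗ B) hp).
Qed.

Lemma refute_matching V (I : Type) (cf : I -> formula V) A R :
  perfect_matching (literal_of [:: A ⊗ A^⊥] cf) R ->
  perfect_matching (literal_of [::] (new_cut A cf)) (push (@refute_node I) R).
Proof.
move=> m.
apply: (@matching_push _ _ _ _ _ _ _
  (fun x => match x with
    | (inl i, p) => (inl i, p)
    | (inr None, p) => (inl 0, p)
    | (inr (Some c), p) => (inr c, p)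
    end) m).
  by move=> [[[|i]|c] p] //=; rewrite ?onth0n.
by move=> [[i|[c|]] p] //=; rewrite ?onth0n.
Qed.

Definition uniup_node I (h : path) (x : node (option I)) : node I :=
  match x with
  | (inl i, p) => (inl i, under h (cons false) p)
  | (inr None, p) => (inl 0, h ++ true :: p)
  | (inr (Some c), p) => (inr c, p)
  end.

Lemma prefix_rcons_in h b (q : path) :
  prefix (rcons h b) (h ++ q) = (if q is d :: _ then b == d else false).
Proof.
by rewrite -cats1 prefix_catr //; rewrite eqxx; case: q => //= d q; rewrite prefix0s andbT.
Qed.

Lemma prefix_rcons_off h b (p : path) :
  ~~ prefix h p -> prefix (rcons h b) p = false.
Proof.
by move=> hp; apply/negbTE; apply: contra hp => /(prefix_trans _); apply;
  rewrite prefix_rcons.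
Qed.

Lemma drop_hole h d (q : path) : drop (size h).+1 (h ++ d :: q) = q.
Proof. by rewrite -cat_rcons drop_size_cat // size_rcons. Qed.

Lemma iup_matching V (I : Type) (cf : I -> formula V) K A B R :
  perfect_matching (literal_of [:: fill K (B ⅋ (A ⊗ A^⊥))] cf) R ->
  perfect_matching (literal_of [:: fill K B] (new_cut A cf))
    (push (iup_node (hole_path K)) R).
Proof.
set h := hole_path K => m.
have holeE C q : leaf_at (fill K C) (h ++ q) = leaf_at C q := leaf_at_hole K C q.
have out p := @leaf_at_outside _ K (B ⅋ (A ⊗ A^⊥)) B p.
apply: (matching_push (g := uniup_node h) m).
  move=> [[[|i]|c] p]; rewrite /iup_node /= ?onth0n //.
  case: (holeP h p) => {}p.
    rewrite holeE !prefix_rcons_in.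
    case: p => [|[] p] //=; rewrite drop_hole.
      by case: p => [|[] p].
    by rewrite under_in holeE.
  by move=> hp; rewrite !prefix_rcons_off //= under_off // out.
move=> [[[|i]|[c|]] p]; rewrite /iup_node /= ?onth0n //.
  case: (holeP h p) => {}p.
    by rewrite under_in !holeE !prefix_rcons_in /= drop_hole.
  by move=> hp; rewrite under_off // !prefix_rcons_off // out.
rewrite prefix_rcons_in eqxx drop_hole holeE.
by case: p => [|[] p].
Qed.

Lemma axiom_net_matching V (A : formula V) (cf : void -> formula V) :
  perfect_matching (literal_of [:: A^⊥ ⅋ A] cf)
    (axiom_link A (fun p => (inl 0, false :: p)) (fun p => (inl 0, true :: p))).
Proof.
apply: (matching_ext (push_axiom _ _ _)).
apply: (@matching_push _ _ _ _ _ _ _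
  (fun x => (head false x.2, behead x.2)) (axiom_matching A)).
  by move=> [[] p].
by move=> [[[|i]|[]] p] //=; rewrite ?onth0n //; case: p => [|[] p].
Qed.

Fixpoint join_path V (T : bracketing V) (i : nat) (p : path) : path :=
  match T with
  | Single _ => p
  | Comma T1 T2 =>
      if i < size (fringe T1) then false :: join_path T1 i p
      else true :: join_path T2 (i - size (fringe T1)) p
  end.

Lemma split_pathK V (T : bracketing V) p : leaf_at (big_par T) p <> None ->
  let: (i, q) := split_path T p in
  [/\ i < size (fringe T), join_path T i q = p
    & obind (fun A => leaf_at A q) (onth (fringe T) i) =
        leaf_at (big_par T) p].
Proof.
elim: T p => [A|T1 IH1 T2 IH2] //= -[|[] p] //= lp.
  have := IH2 _ lp; case: split_path => i q [lt_i <- <-].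
  by rewrite size_cat ltn_add2l lt_i onth_size ltnNge leq_addr addKn.
have := IH1 _ lp; case: split_path => i q [lt_i <- <-].
by rewrite size_cat ltn_addr // onth_lt // lt_i.
Qed.

Lemma join_pathK V (T : bracketing V) i q :
  obind (fun A => leaf_at A q) (onth (fringe T) i) <> None ->
  split_path T (join_path T i q) = (i, q) /\
  leaf_at (big_par T) (join_path T i q) <> None.
Proof.
elim: T i q => [A|T1 IH1 T2 IH2] i q /=.
  by case: i => [|i] /=; rewrite ?onth0n.
case: (split_indexP (size (fringe T1)) i) => {}i.
  by move=> lt_i; rewrite onth_lt // lt_i; apply: IH1.
by rewrite onth_size ltnNge leq_addr addKn /= => /IH2 [-> ?].
Qed.

Lemma split_matching V (T : bracketing V) (I : Type) (cf : I -> formula V) R :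
  perfect_matching (literal_of [:: big_par T] cf) R ->
  perfect_matching (literal_of (fringe T) cf) (push (@split_node V T I) R).
Proof.
move=> m; apply: (@matching_push _ _ _ _ _ _ _
  (fun x => match x with
    | (inl i, p) => (inl 0, join_path T i p)
    | (inr c, p) => (inr c, p)
    end) m).
  move=> [[[|i]|c] p] //=; rewrite ?onth0n //.
  by move=> /split_pathK; case: split_path => i q /= [_ -> ->].
by move=> [[i|c] p] //= /join_pathK [-> ?].
Qed.

Lemma cs_net1_preproof V (C : option (formula V)) (d : cs_proof C) :
  preproof_net (cs_net1 d).
Proof.
rewrite /preproof_net.
have conclE C' (r : cs_proof C') :
    concl (cs_net1 r) = if C' is Some A then [:: A] else [::].
  by case: r.
elim: d => [A|K A B d IH|A d IH|K A B d IH|K A B r d IH] /=.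
- exact: axiom_net_matching.
- by move: IH; rewrite conclE; apply: idown_matching.
- by move: IH; rewrite conclE; apply: refute_matching.
- by move: IH; rewrite conclE; apply: iup_matching.
- by move: IH; rewrite conclE; apply: shuffle_matching.
Qed.

Lemma cs_net_preproof V (T : bracketing V) (d : cs_proof (Some (big_par T))) :
  preproof_net (cs_net d).
Proof.
have := cs_net1_preproof d; rewrite /preproof_net.
have conclE C' (r : cs_proof C') :
    concl (cs_net1 r) = if C' is Some A then [:: A] else [::].
  by case: r.
by rewrite conclE; apply: split_matching.
Qed.

(* Main.v *)
(** Fix a net [N] and label every leaf by its address in [N].  A proof has net [N]
    if and only if, after the labels of its conclusions have been traced upward,
    its identities only link labels that are linked in [N] and its cuts are those
    of [N], each used once: inclusion of the links is enough, since both linkings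
    are perfect matchings.  Both directions therefore reduce to a calculus [der] of
    multisets of labelled formulas with atomic axioms, in which no leaf has to be
    tracked.  In [der] a par can be inverted, and a tensor can be followed up to
    the rule that introduces it; hence every deep rule of the calculus of
    structures is admissible there, without new cuts, by induction on the context.
    Conversely the rules of [der] are simulated deeply, a tensor by replaying one
    of the two proofs in a context that contains the other. *)

From HB Require Import structures.
Require Import Defs.
From mathcomp Require Import all_boot zify.
Set Implicit Arguments.
Unset Strict Implicit.
Unset Printing Implicit Defensive.
Local Open Scope mll_scope.

Local Arguments onth {T} !s !n : simpl nomatch.

(** * Decidable equality of formulas, needed to treat sequents as multisets *)

Section FormulaEq.
Variable W : eqType.

Fixpoint eq_formula (A B : formula W) : bool :=
  match A, B with
  | Pos a, Pos b | Neg a, Neg b => a == b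
  | A1 ⅋ A2, B1 ⅋ B2 | A1 ⊗ A2, B1 ⊗ B2 => eq_formula A1 B1 && eq_formula A2 B2
  | _, _ => false
  end.

Lemma eq_formulaP : Equality.axiom eq_formula.
Proof.
elim=> [a|a|A IHA B IHB|A IHA B IHB] [b|b|C D|C D] /=;
  try by constructor.
- by apply: (iffP eqP) => [->|[]].
- by apply: (iffP eqP) => [->|[]].
- by apply: (iffP andP) => [[/IHA -> /IHB ->]|[<- <-]] //; split; [apply/IHA|apply/IHB].
- by apply: (iffP andP) => [[/IHA -> /IHB ->]|[<- <-]] //; split; [apply/IHA|apply/IHB].
Qed.

HB.instance Definition _ := hasDecEq.Build (formula W) eq_formulaP.

End FormulaEq.

(** * Erasing labels: renaming of atoms, and the lifting of shapes back along it *)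

Section MapFormula.
Variables (W V : Type) (e : W -> V).

Fixpoint map_formula (A : formula W) : formula V :=
  match A with
  | Pos w => Pos (e w)
  | Neg w => Neg (e w)
  | B ⅋ C => map_formula B ⅋ map_formula C
  | B ⊗ C => map_formula B ⊗ map_formula C
  end.

Fixpoint map_context (K : context W) : context V :=
  match K with
  | Hole => Hole
  | ParL K' B => ParL (map_context K') (map_formula B)
  | ParR B K' => ParR (map_formula B) (map_context K')
  | TensL K' B => TensL (map_context K') (map_formula B)
  | TensR B K' => TensR (map_formula B) (map_context K')
  end.

Fixpoint map_bracketing (T : bracketing W) : bracketing V :=
  match T with
  | Single A => Single (map_formula A)
  | Comma T1 T2 => Comma (map_bracketing T1) (map_bracketing T2)
  end.

Lemma leaf_at_map A p :
  leaf_at (map_formula A) p = omap (fun l => (e l.1, l.2)) (leaf_at A p).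
Proof.
by elim: A p => [w|w|A IHA B IHB|A IHA B IHB] [|[] p] //=.
Qed.

Lemma map_fill K A :
  map_formula (fill K A) = fill (map_context K) (map_formula A).
Proof. by elim: K => //= [K -> B|B K ->|K -> B|B K ->]. Qed.

Lemma hole_path_map K : hole_path (map_context K) = hole_path K.
Proof. by elim: K => //= [K ->|B K ->|K ->|B K ->]. Qed.

(** Renaming atoms keeps the connectives, so the hole of a deep rule applied to the erased formula
    can be found in the labelled one. This is how labels are traced upward. *)
Lemma map_fill_inv A K B : map_formula A = fill K B ->
  exists K' B', [/\ A = fill K' B', map_context K' = K & map_formula B' = B].
Proof.
elim: K A => [|K IH C|C K IH|K IH C|C K IH] A /=; first by exists Hole, A.
all: case: A => //= A1 A2 [].
- by move=> /IH [K' [B' [-> <- <-]]] <-; exists (ParL K' A2), B'.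
- by move=> <- /IH [K' [B' [-> <- <-]]]; exists (ParR A1 K'), B'.
- by move=> /IH [K' [B' [-> <- <-]]] <-; exists (TensL K' A2), B'.
- by move=> <- /IH [K' [B' [-> <- <-]]]; exists (TensR A1 K'), B'.
Qed.

Lemma map_shuffle (A B : formula W) (r : shuffle A B) :
  exists r' : shuffle (map_formula A) (map_formula B),
    shuffle_path r' = shuffle_path r.
Proof.
by case: r => *; [exists (com_down _ _)|exists (com_up _ _)|exists (ass_down _ _ _)
  |exists (ass_up _ _ _)|exists (switch _ _ _)].
Qed.

(** A shuffle only rearranges its subformulas, so the labelled conclusion determines the labelled
    premise. *)
Lemma map_shuffle_inv A B (r : shuffle A B) B' : map_formula B' = B ->
  exists A' (r' : shuffle A' B'),
    map_formula A' = A /\ shuffle_path r' = shuffle_path r.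
Proof.
case: r B' => {A B} [A B|A B|A B C|A B C|A B C] [] //= D1 D2 [].
- by move=> <- <-; exists (D2 ⅋ D1), (com_down _ _).
- by move=> <- <-; exists (D2 ⊗ D1), (com_up _ _).
- by case: D1 => //= D0 D1 [<- <-] <-; exists (D0 ⅋ (D1 ⅋ D2)), (ass_down _ _ _).
- by case: D1 => //= D0 D1 [<- <-] <-; exists (D0 ⊗ (D1 ⊗ D2)), (ass_up _ _ _).
- by case: D1 => //= D0 D1 [<- <-] <-; exists (D0 ⊗ (D1 ⅋ D2)), (switch _ _ _).
Qed.

Lemma fringe_map T : fringe (map_bracketing T) = map map_formula (fringe T).
Proof. by elim: T => //= T1 -> T2 ->; rewrite map_cat. Qed.

Lemma big_par_map T : big_par (map_bracketing T) = map_formula (big_par T).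
Proof. by elim: T => //= T1 -> T2 ->. Qed.

Lemma split_path_map T : split_path (map_bracketing T) =1 split_path T.
Proof.
elim: T => [A|T1 IH1 T2 IH2] //= [|[] p] //.
by rewrite IH2 fringe_map size_map.
Qed.

Lemma map_fringe_inv T G : map map_formula G = fringe T ->
  exists T', map_bracketing T' = T /\ fringe T' = G.
Proof.
elim: T G => [A|T1 IH1 T2 IH2] G /=.
  by case: G => [|B [|C G]] //= [<-]; exists (Single B).
move=> eG; have sG : size (fringe T1) <= size G.
  by rewrite -(size_map map_formula) eG size_cat leq_addr.
have [T1' [m1 e1]] : exists T', map_bracketing T' = T1 /\ fringe T' = take (size (fringe T1)) G.
  by apply: IH1; rewrite map_take eG take_size_cat.
have [T2' [m2 e2]] : exists T', map_bracketing T' = T2 /\ fringe T' = drop (size (fringe T1)) G.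
  by apply: IH2; rewrite map_drop eG drop_size_cat.
by exists (Comma T1' T2'); rewrite /= m1 m2 e1 e2 cat_take_drop.
Qed.

End MapFormula.

Lemma map_cat_inv (S T : Type) (f : S -> T) s t1 t2 : map f s = t1 ++ t2 ->
  exists s1 s2, [/\ s = s1 ++ s2, map f s1 = t1 & map f s2 = t2].
Proof.
move=> es; exists (take (size t1) s), (drop (size t1) s).
by split; rewrite ?cat_take_drop // ?map_take ?map_drop es ?take_size_cat ?drop_size_cat.
Qed.

Lemma fringe_nil V (T : bracketing V) : fringe T <> [::].
Proof. by elim: T => // T1 IH T2 _ /=; case: (fringe T1) IH. Qed.

(** * Permutations, decided by counting, and enumerations of the types of cuts *)

Ltac perm_solve :=
  let a := fresh "a" in
  apply/seq.permP => a;
  repeat match goal with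
  | H : is_true (perm_eq _ _) |- _ => move/seq.permP/(_ a): H
  end;
  rewrite ?count_cat /= ?count_cat /= ?count_cat /=; lia.

(** In [der_principal] the first case lets the distinguished formula be taken as principal; the
    second makes it a side formula. *)
Lemma perm_cons_cases (T : eqType) (x y : T) s t :
  perm_eq (x :: s) (y :: t) ->
  x = y /\ perm_eq s t \/
  exists u, perm_eq s (y :: u) /\ perm_eq t (x :: u).
Proof.
move=> p; case: (eqVneq x y) => [exy|nxy].
  by left; split=> //; move: p; rewrite exy perm_cons.
have ys : y \in s.
  have: y \in x :: s by rewrite (perm_mem p) mem_head.
  by rewrite inE eq_sym (negbTE nxy).
right; exists (rem y s); have q := perm_to_rem ys; split=> //.
perm_solve.
Qed.

(** The types of cuts built by the rules (empty, sum, option) are enumerated so that they match the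
    lists of cuts in [der]. *)
Lemma map_enum_void T (f : void -> T) : map f (enum {: void}) = [::].
Proof. by case: (enum _) => [|[]]. Qed.

Lemma map_enum_sum (J J' : finType) T (f : J + J' -> T) :
  map f (enum {: J + J'}) =
    map (fun c => f (inl c)) (enum J) ++ map (fun c => f (inr c)) (enum J').
Proof. by rewrite !enumT [in LHS]unlock /= /sum_enum map_cat -!map_comp. Qed.

Lemma map_enum_option (J : finType) T (f : option J -> T) :
  map f (enum {: option J}) = f None :: map (fun c => f (Some c)) (enum J).
Proof. by rewrite !enumT [in LHS]unlock /= -map_comp. Qed.

(** * Labelled multiset sequents *)

Section Derivation.
Variables (V : Type) (W I : eqType) (e : W -> V).
Variables (cutW : I -> formula W * formula W) (Lk : W -> W -> Prop).

(* [Lk w w'] states that the leaves labelled [w] and [w'] may be linked, and [s] in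
   [der G s] lists the cuts used. *)
Inductive der : seq (formula W) -> seq I -> Prop :=
| der_ax w w' : e w = e w' -> Lk w w' -> Lk w' w -> der [:: Pos w; Neg w'] [::]
| der_par A B G s : der [:: A, B & G] s -> der (A ⅋ B :: G) s
| der_tens A B G D s t :
    der (A :: G) s -> der (B :: D) t -> der (A ⊗ B :: G ++ D) (s ++ t)
| der_cut c G D s t : der ((cutW c).1 :: G) s -> der ((cutW c).2 :: D) t ->
    der (G ++ D) (c :: s ++ t)
| der_perm G G' s s' : perm_eq G G' -> perm_eq s s' -> der G s -> der G' s'.

(* For a non-literal [F] every proof reaches a rule that introduces [F]; if that
   instance can be replaced by one with [H] in place of [F] and extra cuts [u], so
   can the whole proof. *)
Lemma der_principal F H u :
  match F with Pos _ | Neg _ => False | _ => True end ->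
  (forall A B G s, F = A ⅋ B -> der [:: A, B & G] s -> der (H ++ G) (u ++ s)) ->
  (forall A B G D s t, F = A ⊗ B -> der (A :: G) s -> der (B :: D) t ->
     der (H ++ G ++ D) (u ++ s ++ t)) ->
  forall E s, der (F :: E) s -> der (H ++ E) (u ++ s).
Proof.
move=> nlit hpar htens.
(* [F] may stand anywhere in the premises, so the induction is on sequents up to permutation. *)
suff main G s : der G s -> forall E, perm_eq G (F :: E) -> der (H ++ E) (u ++ s).
  by move=> E s /main; apply.
elim=> {G s} [w w' _ _ _|A B G s d IH|A B G D s t d1 IH1 d2 IH2
             |c G D s t d1 IH1 d2 IH2|G G' s s' pG ps d IH] E pE.
- have: F \in [:: Pos w; Neg w'] by rewrite (perm_mem pE) mem_head.
  by rewrite !inE => /orP[] /eqP eF; rewrite eF in nlit.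
- have [[eF p]|[G0 [p q]]] := perm_cons_cases pE.
    apply: der_perm (hpar _ _ _ _ (esym eF) d) => //; perm_solve.
  (* [F] is a side formula: replace it in the premise and apply the same rule again. *)
  apply: (@der_perm (A ⅋ B :: H ++ G0) _ (u ++ s)); [perm_solve|by []|].
  apply: der_par; apply: (@der_perm (H ++ [:: A, B & G0]) _ (u ++ s)); [perm_solve|by []|].
  by apply: IH; perm_solve.
- have [[eF p]|[G0 [p q]]] := perm_cons_cases pE.
    apply: der_perm (htens _ _ _ _ _ _ (esym eF) d1 d2); perm_solve.
  have: F \in G ++ D by rewrite (perm_mem p) mem_head.
  (* The contexts are split between the premises, so only one branch is changed and [u] is added
     once. *)
  rewrite mem_cat => /orP[] /perm_to_rem; [set G1 := rem F G|set G1 := rem F D] => r.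
    apply: (@der_perm (A ⊗ B :: (H ++ G1) ++ D) _ ((u ++ s) ++ t)); [perm_solve|perm_solve|].
    apply: der_tens d2; apply: (@der_perm (H ++ (A :: G1))); [perm_solve|by []|].
    by apply: IH1; perm_solve.
  apply: (@der_perm (A ⊗ B :: G ++ (H ++ G1)) _ (s ++ (u ++ t))); [perm_solve|perm_solve|].
  apply: (der_tens d1); apply: (@der_perm (H ++ (B :: G1))); [perm_solve|by []|].
  by apply: IH2; perm_solve.
(* A cut introduces no formula into its conclusion, so [F] always comes from one of the two
   contexts. *)
- have: F \in G ++ D by rewrite (perm_mem pE) mem_head.
  rewrite mem_cat => /orP[] /perm_to_rem; [set G1 := rem F G|set G1 := rem F D] => r.
    apply: (@der_perm ((H ++ G1) ++ D) _ (c :: (u ++ s) ++ t)); [perm_solve|perm_solve|].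
    apply: der_cut d2; apply: (@der_perm (H ++ ((cutW c).1 :: G1))); [perm_solve|by []|].
    by apply: IH1; perm_solve.
  apply: (@der_perm (G ++ (H ++ G1)) _ (c :: s ++ (u ++ t))); [perm_solve|perm_solve|].
  apply: (der_cut d1); apply: (@der_perm (H ++ ((cutW c).2 :: G1))); [perm_solve|by []|].
  by apply: IH2; perm_solve.
- by apply: (@der_perm (H ++ E) _ (u ++ s)); [|perm_solve|apply: IH; perm_solve].
Qed.

Lemma der_par_inv A B G s : der (A ⅋ B :: G) s -> der [:: A, B & G] s.
Proof.
by apply: (@der_principal _ [:: A; B] [::]) => // A' B' G' s' [<- <-].
Qed.

(** The tensor rule does not invert, its context being split in an unknown way; yet the argument may
    proceed as if the rule introducing the tensor came last. *)
Lemma der_tens_elim A B H u :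
  (forall G D s t, der (A :: G) s -> der (B :: D) t ->
     der (H ++ G ++ D) (u ++ s ++ t)) ->
  forall E s, der (A ⊗ B :: E) s -> der (H ++ E) (u ++ s).
Proof.
by move=> h; apply: der_principal => // A' B' G D s t [<- <-]; apply: h.
Qed.

(** A par on the way to the hole is inverted and put back; a tensor is followed to its introduction,
    where only the premise containing the hole changes. The cuts [u] are thus added just once. *)
Lemma der_deep A B u :
  (forall E s, der (A :: E) s -> der (B :: E) (u ++ s)) ->
  forall K E s, der (fill K A :: E) s -> der (fill K B :: E) (u ++ s).
Proof.
move=> h; elim=> [|K IH C|C K IH|K IH C|C K IH] //= E s.
- by move=> /der_par_inv /IH; apply: der_par.
- move=> /der_par_inv d; apply: der_par.
  apply: (@der_perm [:: fill K B, C & E] _ (u ++ s)); [perm_solve|by []|].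
  by apply: IH; apply: der_perm d; [perm_solve|].
- apply: (@der_tens_elim _ _ [:: _]) => G D s1 t d1 d2.
  apply: (@der_perm (fill K B ⊗ C :: G ++ D) _ ((u ++ s1) ++ t)); [by []|perm_solve|].
  by apply: der_tens => //; apply: IH.
- apply: (@der_tens_elim _ _ [:: _]) => G D s1 t d1 d2.
  apply: (@der_perm (C ⊗ fill K B :: G ++ D) _ (s1 ++ (u ++ t))); [by []|perm_solve|].
  by apply: der_tens => //; apply: IH.
Qed.

Lemma der_shuffle A B (r : shuffle A B) E s : der (A :: E) s -> der (B :: E) s.
Proof.
case: r => {}A {}B => [||C|C|C].
- move=> /der_par_inv d; apply: der_par; apply: der_perm d => //; perm_solve.
- apply: (@der_tens_elim _ _ [:: _] [::]) => G D s1 t d1 d2.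
  apply: (@der_perm (B ⊗ A :: D ++ G) _ (t ++ s1)); [perm_solve|perm_solve|].
  exact: der_tens.
- move=> /der_par_inv d; do 2 apply: der_par.
  have {}d : der (B ⅋ C :: A :: E) s by apply: der_perm d => //; perm_solve.
  by apply: der_perm (der_par_inv d) => //; perm_solve.
- apply: (@der_tens_elim _ _ [:: _] [::]) => G D s1 t d1.
  (* The context and the cuts of the first branch are carried along as part of [H] and [u]. *)
  apply: (@der_tens_elim _ _ [:: _ & _] s1) => G' D' s2 t' d2 d3.
  apply: (@der_perm (((A ⊗ B) ⊗ C) :: (G ++ G') ++ D') _ ((s1 ++ s2) ++ t'));
    [perm_solve|perm_solve|].
  by do 2 apply: der_tens => //.
(* Switch: once [B ⅋ C] is inverted, [C] counts as context of the right premise, and [A ⊗ B] is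
   introduced beside it. *)
- apply: (@der_tens_elim _ _ [:: _] [::]) => G D s1 t d1 /der_par_inv d2.
  apply: der_par; apply: (@der_perm (A ⊗ B :: G ++ (C :: D)) _ (s1 ++ t));
    [perm_solve|by []|].
  exact: der_tens.
Qed.

(** The links an identity would create between [A'] and [A]; both orders are listed because [Lk] is
    an arbitrary relation. *)
Definition mirror_links (A' A : formula W) : Prop :=
  forall p l m, leaf_at A' (mirror p) = Some l -> leaf_at A p = Some m ->
    Lk l.1 m.1 /\ Lk m.1 l.1.

(** Expansion of a general identity into atomic ones, following the formula. *)
Lemma der_id A A' : map_formula e A' = (map_formula e A)^⊥ ->
  mirror_links A' A -> der [:: A'; A] [::].
Proof.
elim: A A' => [w|w|A IHA B IHB|A IHA B IHB] [w'|w'|B' A'|B' A'] //= [].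
- move=> ee h; have [//|h1 h2] := h [::] (w', false) (w, true) erefl.
  by apply: (@der_perm [:: Pos w; Neg w'] _ [::]) => //; [perm_solve|apply: der_ax].
- move=> ee h; have [//|h1 h2] := h [::] (w', true) (w, false) erefl.
  exact: der_ax.
(* [mirror] exchanges left and right, so the right component is matched with the left component of
   the dual. *)
- move=> eB eA h; have dB := IHB _ eB (fun p => h (true :: p)).
  have dA := IHA _ eA (fun p => h (false :: p)).
  apply: (@der_perm [:: A ⅋ B; B' ⊗ A'] _ [::]) => //; first by perm_solve.
  apply: der_par; apply: (@der_perm (B' ⊗ A' :: [:: B] ++ [:: A]) _ ([::] ++ [::])) => //.
    by perm_solve.
  exact: der_tens.
- move=> eB eA h; have dB := IHB _ eB (fun p => h (true :: p)).
  have dA := IHA _ eA (fun p => h (false :: p)).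
  apply: der_par.
  apply: (@der_perm (A ⊗ B :: [:: A'] ++ [:: B']) _ ([::] ++ [::])) => //.
    by perm_solve.
  apply: der_tens; [apply: der_perm dA => //|apply: der_perm dB => //]; perm_solve.
Qed.

Lemma der_idown A A' B E s : der [:: A'; A] [::] -> der (B :: E) s ->
  der ((A' ⅋ A) ⊗ B :: E) s.
Proof.
move=> d1 d2; exact: (@der_tens (A' ⅋ A) B [::] E [::] s (der_par d1) d2).
Qed.

(** The rule that introduced the removed tensor is turned into a cut on the same two premises. *)
Lemma der_iup c B E s : der (B ⅋ ((cutW c).1 ⊗ (cutW c).2) :: E) s ->
  der (B :: E) (c :: s).
Proof.
move=> /der_par_inv d.
apply: (@der_tens_elim _ _ [::] [:: c]) (der_perm _ _ d); last by [].
  by move=> G D s1 t; apply: der_cut.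
by perm_solve.
Qed.

(** * Nets whose leaves are labelled *)

Hypothesis cutW_dual :
  forall c, map_formula e (cutW c).2 = (map_formula e (cutW c).1)^⊥.

(** [f] tells which cut of the fixed net each cut stands for; the labels of a cut tree, absent from
    the conclusions, are read there. *)
Definition name_at (G : seq (formula W)) (J : Type) (f : J -> I) (x : node J) :
    option (W * bool) :=
  match x with
  | (inl i, p) => obind (fun A => leaf_at A p) (onth G i)
  | (inr c, d :: p) =>
      leaf_at (if d then (cutW (f c)).2 else (cutW (f c)).1) p
  | (inr c, [::]) => None
  end.

Lemma literal_name G J (cf : J -> formula V) (f : J -> I) x :
  (forall c, cf c = map_formula e (cutW (f c)).1) ->
  literal_of (map (map_formula e) G) cf x =
    omap (fun l => (e l.1, l.2)) (name_at G f x).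
Proof.
move=> cfE; case: x => -[i|c] p /=.
  by rewrite onth_map; case: onth => //= A; apply: leaf_at_map.
by case: p => [|[] p] //; rewrite cfE -?cutW_dual leaf_at_map.
Qed.

Definition links G J (f : J -> I) (R : node J -> node J -> Prop) : Prop :=
  forall x y l m, R x y -> name_at G f x = Some l -> name_at G f y = Some m ->
    Lk l.1 m.1.

(** Keeps [links] from holding vacuously at nodes without a label. *)
Definition named G J (f : J -> I) (R : node J -> node J -> Prop) : Prop :=
  forall x y, R x y -> name_at G f x <> None /\ name_at G f y <> None.

Definition name_preserving G J (f : J -> I) G' J' (f' : J' -> I)
    (h : node J -> node J') : Prop :=
  forall x l, name_at G f x = Some l -> name_at G' f' (h x) = Some l.

(** Leaves keep their labels when a rule moves them. By [named] no linked node of the premise can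
    acquire a label only after the move. *)
Lemma links_push G J (f : J -> I) G' J' (f' : J' -> I) h R :
  named G f R -> name_preserving G f G' f' h ->
  links G' f' (push h R) <-> links G f R.
Proof.
move=> nR hh; split=> [L x y l m Rxy /hh nx /hh ny|L _ _ l m [u [v [Ruv -> ->]]]].
  by apply: L nx ny; exists x, y.
have := nR _ _ Ruv.
case nu: (name_at G f u) => [l'|] [] // _; case nv: (name_at G f v) => [m'|] // _.
by rewrite (hh _ _ nu) (hh _ _ nv) => -[<-] [<-]; apply: L Ruv nu nv.
Qed.

Lemma links_union G J (f : J -> I) R1 R2 :
  links G f (union_link R1 R2) <-> links G f R1 /\ links G f R2.
Proof.
split=> [L|[L1 L2] x y l m []]; [|exact: L1|exact: L2].
by split=> x y l m Rxy; apply: L; [left|right].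
Qed.

Lemma links_axiom G J (f : J -> I) A A' a b :
  (forall p, name_at G f (a p) = leaf_at A' p) ->
  (forall p, name_at G f (b p) = leaf_at A p) ->
  links G f (axiom_link (map_formula e A) a b) <-> mirror_links A' A.
Proof.
move=> ha hb; split=> [L p l m lp mp|L x y l m [p _ [[-> ->]|[-> ->]]]].
- have np : leaf_at (map_formula e A) p <> None by rewrite leaf_at_map mp.
  split; [apply: (L (a (mirror p)) (b p))|apply: (L (b p) (a (mirror p)))];
    rewrite ?ha ?hb //; exists p => //; by [left|right].
- by rewrite ha hb => hl hm; case: (L _ _ _ hl hm).
- by rewrite ha hb => hl hm; case: (L _ _ _ hm hl).
Qed.

Lemma exch_name G A B D J (f : J -> I) :
  name_preserving (G ++ [:: A, B & D]) f (G ++ [:: B, A & D]) f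
    (exch_node (size G)).
Proof.
move=> [[i|c] p] l //=; case: (split_indexP (size G) i) => {}i.
  by move=> lt_i; have [_ -> ->] := belowE lt_i; rewrite !onth_lt.
have [_ -> ->] := shiftE (size G) i; rewrite onth_size.
case: i => [|[|i]] /=.
  by rewrite -addn1 onth_size.
  by rewrite -[X in onth _ X]addn0 onth_size.
by rewrite onth_size.
Qed.

Lemma par_name G A B D J (f : J -> I) :
  name_preserving (G ++ [:: A, B & D]) f (G ++ A ⅋ B :: D) f
    (par_node (size G)).
Proof.
move=> [[i|c] p] l //=; case: (split_indexP (size G) i) => {}i.
  by move=> lt_i; have [-> _ _] := belowE lt_i; rewrite /= !onth_lt.
have [-> -> ->] := shiftE (size G) i; rewrite onth_size.
case: i => [|[|i]] /=; rewrite ?onth_mid //.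
by rewrite addnS /= onth_size.
Qed.

Lemma tens_name_l G A B D J J' (f : J + J' -> I) :
  name_preserving (G ++ [:: A]) (fun c => f (inl c)) (G ++ A ⊗ B :: D) f
    (@tens_node_l J J' (size G)).
Proof.
move=> [[i|c] p] l //=; case: (split_indexP (size G) i) => {}i.
  by move=> lt_i; have [_ -> _] := belowE lt_i; rewrite !onth_lt.
have [_ -> _] := shiftE (size G) i; rewrite !onth_size.
by case: i => [|i] //=; rewrite onth0n.
Qed.

Lemma tens_name_r G A B D J J' (f : J + J' -> I) :
  name_preserving (B :: D) (fun c => f (inr c)) (G ++ A ⊗ B :: D) f
    (@tens_node_r J J' (size G)).
Proof. by move=> [[[|i]|c] p] l //=; rewrite onth_size. Qed.

(** The cut formula is labelled as the cut [f None] prescribes, so its leaves keep their labels on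
    moving into the new cut tree. *)
Lemma cut_name_l G D J J' (f : option (J + J') -> I) :
  name_preserving (G ++ [:: (cutW (f None)).1]) (fun c => f (Some (inl c)))
    (G ++ D) f (@cut_node_l J J' (size G)).
Proof.
move=> [[i|c] p] l //=; case: (split_indexP (size G) i) => {}i.
  by move=> lt_i; have [_ -> _] := belowE lt_i; rewrite /= !onth_lt.
have [_ -> _] := shiftE (size G) i; rewrite onth_size.
by case: i => [|i] //=; rewrite onth0n.
Qed.

Lemma cut_name_r G D J J' (f : option (J + J') -> I) :
  name_preserving ((cutW (f None)).2 :: D) (fun c => f (Some (inr c)))
    (G ++ D) f (@cut_node_r J J' (size G)).
Proof. by move=> [[[|i]|c] p] l //=; rewrite onth_size. Qed.

Lemma idown_name K B C J (f : J -> I) :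
  name_preserving [:: fill K B] f [:: fill K (C ⊗ B)] f
    (deep_node (hole_path K) (cons true)).
Proof.
move=> [[[|i]|c] p] l //=; rewrite ?onth0n //.
case: (holeP (hole_path K) p) => {}p; first by rewrite under_in !leaf_at_hole.
by move=> hp; rewrite under_off // (leaf_at_outside B (C ⊗ B) hp).
Qed.

Lemma shuffle_name K A B (r : shuffle A B) J (f : J -> I) :
  name_preserving [:: fill K A] f [:: fill K B] f
    (deep_node (hole_path K) (shuffle_path r)).
Proof.
move=> [[[|i]|c] p] l //=; rewrite ?onth0n //.
case: (holeP (hole_path K) p) => {}p.
  rewrite under_in !leaf_at_hole => lp.
  by have [|-> _] := @shuffle_pathK _ _ _ r p; rewrite lp.
by move=> hp; rewrite under_off // (leaf_at_outside A B hp).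
Qed.

Lemma iup_name K B J (f : option J -> I) :
  name_preserving
    [:: fill K (B ⅋ ((cutW (f None)).1 ⊗ (cutW (f None)).2))]
    (fun c => f (Some c)) [:: fill K B] f (iup_node (hole_path K)).
Proof.
move=> [[[|i]|c] p] l; rewrite /iup_node /= ?onth0n //.
case: (holeP (hole_path K) p) => {}p.
  rewrite leaf_at_hole !prefix_rcons_in.
  case: p => [|[] p] //=; rewrite drop_hole; last by rewrite leaf_at_hole.
  by case: p => [|[] p].
move=> hp; rewrite !prefix_rcons_off //=.
by rewrite (leaf_at_outside (B ⅋ ((cutW (f None)).1 ⊗ (cutW (f None)).2)) B hp).
Qed.

Lemma split_name T J (f : J -> I) :
  name_preserving [:: big_par T] f (fringe T) f (@split_node V (map_bracketing e T) J).
Proof.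
move=> [[[|i]|c] p] l //=; rewrite ?onth0n // split_path_map => lp.
by have := @split_pathK _ T p; rewrite lp; case: split_path => i q [|_ _] //= ->.
Qed.

Definition decorates (N : linked_forest V) G (f : cut N -> I) : Prop :=
  concl N = map (map_formula e) G /\
  forall c, cut_formula c = map_formula e (cutW (f c)).1.

(** That each cut is used once is not included: it is expressed separately, by comparing the values
    of [f] with a list of cuts up to permutation. *)
Definition represents (N : linked_forest V) G (f : cut N -> I) : Prop :=
  decorates G f /\ links G f (@link V N).

Lemma preproof_named (N : linked_forest V) G (f : cut N -> I) :
  preproof_net N -> decorates G f -> named G f (@link V N).
Proof.
move=> [_ lN _] [cN fN] x y /lN [a [b]].
by rewrite cN !(literal_name _ _ fN); case: name_at => [l|]; case: name_at => [m|] [].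
Qed.

(** * Sequent calculus proofs *)

Lemma sc_concl (G : seq (formula V)) (pi : sc_proof G) : concl (sc_net pi) = G.
Proof. by case: pi. Qed.

Lemma sc_der (G0 : seq (formula V)) (pi : sc_proof G0) G (f : cut (sc_net pi) -> I) :
  represents G f -> der G (map f (enum (cut (sc_net pi)))).
Proof.
elim: pi G f => [A|{}G0 A B D pi IH|{}G0 A B D pi IH|{}G0 A B D pi1 IH1 pi2 IH2
                |{}G0 A D pi1 IH1 pi2 IH2] G f [[/= cE fE]].
- case: G cE => [|A1 [|A2 [|]]] //= [e1 e2]; rewrite {}e2 in e1 *.
  move=> L; rewrite map_enum_void; apply: der_id; first by [].
  exact: proj1 (@links_axiom [:: A1; A2] _ f A2 A1 (fun p => (inl 0, p))
    (fun p => (inl 1, p)) (fun=> erefl) (fun=> erefl)) L.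
- have [G1 [G2 [-> e1]]] := map_cat_inv (esym cE).
  case: G2 => [|B' [|A' D']] //= [eB eA eD]; subst G0 A B D; rewrite size_map => L.
  have dec : @decorates (sc_net pi) (G1 ++ [:: A', B' & D']) f.
    by split; rewrite // sc_concl map_cat.
  have nam := preproof_named (sc_net_preproof pi) dec.
  have rep := proj1 (links_push nam (@exch_name G1 A' B' D' _ f)) L.
  by apply: der_perm (IH _ _ (conj dec rep)); [perm_solve|].
- have [G1 [G2 [-> e1]]] := map_cat_inv (esym cE).
  case: G2 => [|[|| A' B'|] D'] //= [eA eB eD]; subst G0 A B D; rewrite size_map => L.
  have dec : @decorates (sc_net pi) (G1 ++ [:: A', B' & D']) f.
    by split; rewrite // sc_concl map_cat.
  have nam := preproof_named (sc_net_preproof pi) dec.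
  have rep := proj1 (links_push nam (@par_name G1 A' B' D' _ f)) L.
  apply: (@der_perm (A' ⅋ B' :: G1 ++ D') _ (map f (enum (cut (sc_net pi))))) => //.
    by perm_solve.
  by apply: der_par; apply: der_perm (IH _ _ (conj dec rep)); [perm_solve|].
- have [G1 [G2 [-> e1]]] := map_cat_inv (esym cE).
  case: G2 => [|[|| |A' B'] D'] //= [eA eB eD]; subst G0 A B D; rewrite size_map.
  move=> /links_union [L1 L2].
  have dec1 : @decorates (sc_net pi1) (G1 ++ [:: A']) (fun c => f (inl c)).
    by split=> [|c]; [rewrite sc_concl map_cat|exact: (fE (inl c))].
  have nam1 := preproof_named (sc_net_preproof pi1) dec1.
  have rep1 := proj1 (links_push nam1 (@tens_name_l G1 A' B' D' _ _ f)) L1.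
  have dec2 : @decorates (sc_net pi2) (B' :: D') (fun c => f (inr c)).
    by split=> [|c]; [rewrite sc_concl|exact: (fE (inr c))].
  have nam2 := preproof_named (sc_net_preproof pi2) dec2.
  have rep2 := proj1 (links_push nam2 (@tens_name_r G1 A' B' D' _ _ f)) L2.
  rewrite map_enum_sum.
  have d1 : der (A' :: G1) (map (fun c => f (inl c)) (enum (cut (sc_net pi1)))).
    by apply: der_perm (IH1 _ _ (conj dec1 rep1)); [perm_solve|].
  by apply: der_perm (der_tens d1 (IH2 _ _ (conj dec2 rep2))); [perm_solve|].
- have [G1 [G2 [-> e1 eD]]] := map_cat_inv (esym cE); subst G0 D; rewrite size_map.
  (* The type of [f] mentions [A], so [f None] is hidden behind [c] before [A] is replaced by an
     expression in it. *)
  move=> /links_union [L1 L2]; have [c ec] : exists c, f None = c by exists (f None).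
  have := fE None; rewrite /= ec => eA; subst A.
  have dec1 : @decorates (sc_net pi1) (G1 ++ [:: (cutW (f None)).1])
      (fun c => f (Some (inl c))).
    by split=> [|i]; [rewrite sc_concl map_cat ec|exact: (fE (Some (inl i)))].
  have nam1 := preproof_named (sc_net_preproof pi1) dec1.
  have rep1 := proj1 (links_push nam1 (@cut_name_l G1 G2 _ _ f)) L1.
  have dec2 : @decorates (sc_net pi2) ((cutW (f None)).2 :: G2)
      (fun c => f (Some (inr c))).
    by split=> [|i]; [rewrite sc_concl /= ec cutW_dual|exact: (fE (Some (inr i)))].
  have nam2 := preproof_named (sc_net_preproof pi2) dec2.
  have rep2 := proj1 (links_push nam2 (@cut_name_r G1 G2 _ _ f)) L2.
  rewrite map_enum_option map_enum_sum.
  apply: der_cut (IH2 _ _ (conj dec2 rep2)).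
  by apply: der_perm (IH1 _ _ (conj dec1 rep1)); [perm_solve|].
Qed.

(** [G0] is existential, although [represents] forces it to be the erasure of [G], to avoid casts
    between types of proofs of equal sequents. *)
Definition sc_realizable G (s : seq I) : Prop :=
  exists (G0 : seq (formula V)) (pi : sc_proof G0) (f : cut (sc_net pi) -> I),
    represents G f /\ perm_eq (map f (enum (cut (sc_net pi)))) s.

Lemma sc_realizable_inv G s : sc_realizable G s ->
  exists (pi : sc_proof (map (map_formula e) G)) (f : cut (sc_net pi) -> I),
    [/\ decorates G f, named G f (@link _ (sc_net pi)), links G f (@link _ (sc_net pi))
      & perm_eq (map f (enum (cut (sc_net pi)))) s].
Proof.
move=> [G0 [pi [f [[dec L] ps]]]]; have := dec.1; rewrite sc_concl => eG; subst G0.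
by exists pi, f; split=> //; apply: preproof_named (sc_net_preproof pi) dec.
Qed.

Lemma sc_realizable_exch G A B D s :
  sc_realizable (G ++ [:: A, B & D]) s -> sc_realizable (G ++ [:: B, A & D]) s.
Proof.
move=> /sc_realizable_inv; rewrite map_cat => -[pi [f [dec nam L ps]]].
exists _, (sc_exch pi), f; split=> //; split; first by split; rewrite ?map_cat //; exact: dec.2.
by rewrite /= size_map; apply/(links_push nam (@exch_name _ _ _ _ _ f)).
Qed.

Lemma sc_realizable_par G A B D s :
  sc_realizable (G ++ [:: A, B & D]) s -> sc_realizable (G ++ A ⅋ B :: D) s.
Proof.
move=> /sc_realizable_inv; rewrite map_cat => -[pi [f [dec nam L ps]]].
exists _, (sc_par pi), f; split=> //; split; first by split; rewrite ?map_cat //; exact: dec.2.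
by rewrite /= size_map; apply/(links_push nam (@par_name _ _ _ _ _ f)).
Qed.

Lemma sc_realizable_tens G A B D s t :
  sc_realizable (G ++ [:: A]) s -> sc_realizable (B :: D) t ->
  sc_realizable (G ++ A ⊗ B :: D) (s ++ t).
Proof.
move=> /sc_realizable_inv; rewrite map_cat => -[pi1 [f1 [dec1 nam1 L1 ps1]]].
move=> /sc_realizable_inv [pi2 [f2 [dec2 nam2 L2 ps2]]].
pose f (c : cut (sc_net pi1) + cut (sc_net pi2)) :=
  match c with inl c => f1 c | inr c => f2 c end.
exists _, (sc_tens pi1 pi2), f; split; last by rewrite /= map_enum_sum perm_cat.
split; first by split=> [|[c|c]]; rewrite ?map_cat //; [exact: dec1.2|exact: dec2.2].
rewrite /= size_map; apply/links_union; split.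
  by apply/(links_push nam1 (@tens_name_l _ _ _ _ _ _ f)).
by apply/(links_push nam2 (@tens_name_r _ _ _ _ _ _ f)).
Qed.

Lemma sc_realizable_cut c G D s t :
  sc_realizable (G ++ [:: (cutW c).1]) s -> sc_realizable ((cutW c).2 :: D) t ->
  sc_realizable (G ++ D) (c :: s ++ t).
Proof.
move=> /sc_realizable_inv; rewrite map_cat => -[pi1 [f1 [dec1 nam1 L1 ps1]]].
move=> /sc_realizable_inv /=; rewrite cutW_dual => -[pi2 [f2 [dec2 nam2 L2 ps2]]].
pose f (i : option (cut (sc_net pi1) + cut (sc_net pi2))) :=
  match i with None => c | Some (inl i) => f1 i | Some (inr i) => f2 i end.
exists _, (sc_cut pi1 pi2), f; split.
  split.
    by split=> [|[[i|i]|]]; rewrite ?map_cat //; [exact: dec1.2|exact: dec2.2].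
  rewrite /= size_map; apply/links_union; split.
    by apply/(links_push nam1 (@cut_name_l _ _ _ _ f)).
  by apply/(links_push nam2 (@cut_name_r _ _ _ _ f)).
by rewrite /= map_enum_option map_enum_sum perm_cons perm_cat.
Qed.

Lemma sc_realizable_ax w w' : e w = e w' -> Lk w w' -> Lk w' w ->
  sc_realizable [:: Pos w; Neg w'] [::].
Proof.
move=> ew l1 l2; pose f (c : void) : I := match c with end.
exists _, (sc_id (Neg (e w'))), f; split; last by rewrite map_enum_void.
split; first by split=> [|[]]; rewrite /= ew.
apply/(@links_axiom _ _ _ (Neg w') (Pos w)) => //.
by move=> [|? ?] //= ? ? [<-] [<-].
Qed.

(** Exchanges act as in insertion sort: the tail is permuted behind the head, then [move_front]
    carries the head across [G1] to its place. *)
Lemma sc_realizable_perm_cat H G G' s :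
  perm_eq G G' -> sc_realizable (H ++ G) s -> sc_realizable (H ++ G') s.
Proof.
have move_front A G1 D H' : sc_realizable (H' ++ A :: G1 ++ D) s ->
    sc_realizable (H' ++ G1 ++ A :: D) s.
  elim: G1 H' => [|B G1 IH] H' //= /sc_realizable_exch.
  by rewrite -cat_rcons => /IH; rewrite cat_rcons.
elim: G G' H => [|A G IH] G' H pG;
  first by case: G' pG => // B G' /perm_size.
have AG' : A \in G' by rewrite -(perm_mem pG) mem_head.
case/splitPr: AG' pG => G1 D pG dG; apply: move_front; rewrite -cat_rcons.
by apply: IH; [perm_solve|rewrite cat_rcons].
Qed.

Lemma der_sc G s : der G s -> sc_realizable G s.
Proof.
elim=> {G s} [w w'|A B G s _|A B G D s t _ IH1 _ IH2|c G D s t _ IH1 _ IH2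
             |G G' s s' pG ps _ IH].
- exact: sc_realizable_ax.
- exact: (@sc_realizable_par [::]).
- apply: (@sc_realizable_perm_cat [::] (G ++ A ⊗ B :: D)); first by perm_solve.
  apply: sc_realizable_tens IH2.
  by apply: (@sc_realizable_perm_cat [::] (A :: G)); first perm_solve.
- apply: sc_realizable_cut IH2.
  by apply: (@sc_realizable_perm_cat [::] ((cutW c).1 :: G)); first perm_solve.
- have := @sc_realizable_perm_cat [::] _ _ _ pG IH.
  move=> [G0 [pi [f [rep p]]]]; exists G0, pi, f; split=> //.
  exact: perm_trans ps.
Qed.

(** * Proofs in the calculus of structures *)

Lemma cs_concl (C : option (formula V)) (d : cs_proof C) :
  concl (cs_net1 d) = if C is Some A then [:: A] else [::].
Proof. by case: d. Qed.

(** Each rule is shallowly admissible in [der], hence deeply by [der_deep], with [i↑] adding the cut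
    [f None]. A final context-free [i↑] is excluded, as it leaves no conclusion. *)
Lemma cs_der (C : option (formula V)) (d : cs_proof C) A
    (f : cut (cs_net1 d) -> I) :
  represents [:: A] f -> der [:: A] (map f (enum (cut (cs_net1 d)))).
Proof.
elim: d A f => [A|K A B d IH|A d IH|K A B d IH|K A B r d IH] A0 f [[/= cE fE]] //.
- case: cE => cE; case: A0 cE => //= A1 A2 [e1 e2]; rewrite {}e2 in e1 * => L.
  rewrite map_enum_void; apply: der_par; apply: der_id; first by [].
  exact: proj1 (@links_axiom [:: A1 ⅋ A2] _ f A2 A1 (fun p => (inl 0, false :: p))
    (fun p => (inl 0, true :: p)) (fun=> erefl) (fun=> erefl)) L.
- case: cE => /esym /map_fill_inv [K' [F [-> eK]]].
  case: F => //= -[|||] // A1 A2 B' [e1 e2 eB].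
  subst K A B; rewrite hole_path_map.
  move=> /links_union [L1 L2].
  have dec : @decorates (cs_net1 d) [:: fill K' B'] f.
    by split; rewrite // cs_concl /= map_fill.
  have nam := preproof_named (cs_net1_preproof d) dec.
  have rep := proj1 (links_push nam (@idown_name K' B' (A1 ⅋ A2) _ f)) L1.
  apply: (@der_deep _ _ [::] _ K' [::] _ (IH _ _ (conj dec rep))) => E s.
  apply: der_idown; apply: der_id; first by [].
  apply: (proj1 (@links_axiom [:: fill K' ((A1 ⅋ A2) ⊗ B')] _ f A2 A1
    (fun p => (inl 0, hole_path K' ++ [:: false, false & p]))
    (fun p => (inl 0, hole_path K' ++ [:: false, true & p])) _ _) L2) => p /=;
    by rewrite leaf_at_hole.
- case: cE => /esym /map_fill_inv [K' [B' [-> eK eB]]]; subst K B.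
  rewrite hole_path_map => L.
  have [c ec] : exists c, f None = c by exists (f None).
  have := fE None; rewrite /= ec => eA; subst A.
  have dec : @decorates (cs_net1 d)
      [:: fill K' (B' ⅋ ((cutW (f None)).1 ⊗ (cutW (f None)).2))] (fun i => f (Some i)).
    by split=> [|i]; [rewrite cs_concl /= map_fill ec /= cutW_dual|exact: (fE (Some i))].
  have nam := preproof_named (cs_net1_preproof d) dec.
  have rep := proj1 (links_push nam (@iup_name K' B' _ f)) L.
  rewrite map_enum_option.
  apply: (@der_deep _ _ [:: f None] _ K' [::] _ (IH _ _ (conj dec rep))) => E s.
  exact: der_iup.
- case: cE => /esym /map_fill_inv [K' [B' [-> eK eB]]]; subst K.
  have [A' [r' [eA er]]] := map_shuffle_inv r eB; subst A B.
  rewrite hole_path_map -er => L.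
  have dec : @decorates (cs_net1 d) [:: fill K' A'] f.
    by split; rewrite // cs_concl /= map_fill.
  have nam := preproof_named (cs_net1_preproof d) dec.
  have rep := proj1 (links_push nam (@shuffle_name K' _ _ r' _ f)) L.
  apply: (@der_deep _ _ [::] _ K' [::] _ (IH _ _ (conj dec rep))) => E s.
  exact: der_shuffle.
Qed.

Definition cs_realizable A (s : seq I) : Prop :=
  exists (C : option (formula V)) (d : cs_proof C) (f : cut (cs_net1 d) -> I),
    represents [:: A] f /\ perm_eq (map f (enum (cut (cs_net1 d)))) s.

Lemma cs_realizable_inv A s : cs_realizable A s ->
  exists (d : cs_proof (Some (map_formula e A))) (f : cut (cs_net1 d) -> I),
    [/\ decorates [:: A] f, named [:: A] f (@link _ (cs_net1 d)),
        links [:: A] f (@link _ (cs_net1 d))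
      & perm_eq (map f (enum (cut (cs_net1 d)))) s].
Proof.
move=> [C [d [f [[dec L] ps]]]]; have := dec.1; rewrite cs_concl.
case: C d f dec L ps => // A' d f dec L ps [eA]; subst A'.
by exists d, f; split=> //; apply: preproof_named (cs_net1_preproof d) dec.
Qed.

Lemma cs_realizable_perm A s t :
  perm_eq s t -> cs_realizable A s -> cs_realizable A t.
Proof.
move=> p [C [d [f [rep ps]]]]; exists C, d, f; split=> //; exact: perm_trans p.
Qed.

Lemma cs_realizable_axiom A A' : map_formula e A' = (map_formula e A)^⊥ ->
  mirror_links A' A -> cs_realizable (A' ⅋ A) [::].
Proof.
move=> eA L; pose f (c : void) : I := match c with end.
exists _, (cs_axiom (map_formula e A)), f; split; last by rewrite map_enum_void.
split; first by split=> [|[]]; rewrite /= eA.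
exact: proj2 (@links_axiom [:: A' ⅋ A] _ f A A' (fun p => (inl 0, false :: p))
    (fun p => (inl 0, true :: p)) (fun=> erefl) (fun=> erefl)) L.
Qed.

(** A derivation from [A] to [B] with cuts [u], seen through its effect on proofs; quantifying over
    [K] allows its use at any depth. *)
Definition step A B u : Prop :=
  forall K s, cs_realizable (fill K A) s -> cs_realizable (fill K B) (u ++ s).

Lemma step_shuffle A B (r : shuffle A B) : step A B [::].
Proof.
move=> K s /cs_realizable_inv; rewrite map_fill => -[d [f [dec nam L ps]]].
have [r' er] := map_shuffle e r.
exists _, (cs_shuffle r' d), f; split=> //; split.
  by split; rewrite /= ?map_fill //; exact: dec.2.
by rewrite /= hole_path_map er; apply/(links_push nam (@shuffle_name _ _ _ r _ f)).
Qed.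

Lemma step_idown A A' B : map_formula e A' = (map_formula e A)^⊥ ->
  mirror_links A' A -> step B ((A' ⅋ A) ⊗ B) [::].
Proof.
move=> eA mL K s /cs_realizable_inv; rewrite map_fill => -[d [f [dec nam L ps]]].
exists _, (cs_idown (map_formula e A) d), f; split=> //; split.
  by split; rewrite /= ?map_fill //= ?eA //; exact: dec.2.
rewrite /= hole_path_map; apply/links_union; split.
  by apply/(links_push nam (@idown_name _ _ _ _ f)).
apply: (proj2 (@links_axiom [:: fill K ((A' ⅋ A) ⊗ B)] _ f A A'
    (fun p => (inl 0, hole_path K ++ [:: false, false & p]))
    (fun p => (inl 0, hole_path K ++ [:: false, true & p])) _ _)) => // p /=;
  by rewrite leaf_at_hole.
Qed.

Lemma step_iup c B : step (B ⅋ ((cutW c).1 ⊗ (cutW c).2)) B [:: c].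
Proof.
move=> K s /cs_realizable_inv; rewrite map_fill /= cutW_dual => -[d [f [dec nam L ps]]].
pose f' (i : option (cut (cs_net1 d))) := if i is Some j then f j else c.
exists _, (cs_iup d), f'; split; last by rewrite /= map_enum_option perm_cons.
split; first by split=> [|[i|]]; rewrite /= ?map_fill //; exact: dec.2.
by rewrite /= hole_path_map; apply/(links_push nam (@iup_name _ _ _ f')).
Qed.

Lemma step_refl A : step A A [::].
Proof. by []. Qed.

Lemma step_trans B A C u v : step A B u -> step B C v -> step A C (v ++ u).
Proof. by move=> h1 h2 K s /h1 /h2; rewrite catA. Qed.

Lemma step_trans0 B A C : step A B [::] -> step B C [::] -> step A C [::].
Proof. exact: step_trans. Qed.

Fixpoint context_comp (K L : context W) : context W :=
  match K with
  | Hole => L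
  | ParL K' B => ParL (context_comp K' L) B
  | ParR B K' => ParR B (context_comp K' L)
  | TensL K' B => TensL (context_comp K' L) B
  | TensR B K' => TensR B (context_comp K' L)
  end.

Lemma fill_comp K L A : fill (context_comp K L) A = fill K (fill L A).
Proof. by elim: K => //= [K -> B|B K ->|K -> B|B K ->]. Qed.

Lemma step_fill L A B u : step A B u -> step (fill L A) (fill L B) u.
Proof. by move=> h K s; rewrite -!fill_comp; apply: h. Qed.

Arguments step_fill L {A B u} h K s.

(** * Pars over nonempty lists, up to bracketing and order *)

Fixpoint pars (A : formula W) (G : seq (formula W)) : formula W :=
  if G is B :: G' then A ⅋ pars B G' else A.

Definition par_equiv A B : Prop := step A B [::] /\ step B A [::].

Lemma par_equiv_sym A B : par_equiv A B -> par_equiv B A.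
Proof. by case. Qed.

Lemma par_equiv_trans B A C : par_equiv A B -> par_equiv B C -> par_equiv A C.
Proof.
move=> [h1 h2] [h3 h4].
by split; [apply: step_trans0 h1 h3|apply: step_trans0 h4 h2].
Qed.

Lemma par_equivC A B : par_equiv (A ⅋ B) (B ⅋ A).
Proof. by split; apply: step_shuffle; apply: com_down. Qed.

Lemma par_equivA A B C : par_equiv (A ⅋ (B ⅋ C)) ((A ⅋ B) ⅋ C).
Proof.
split; first by apply: step_shuffle; apply: ass_down.
(* Only one direction of associativity is a rule. The other passes through [C ⅋ (A ⅋ B)],
   [(C ⅋ A) ⅋ B], [B ⅋ (C ⅋ A)] and [(B ⅋ C) ⅋ A]. *)
have com X Y := (par_equivC X Y).1.
have ass X Y Z : step (X ⅋ (Y ⅋ Z)) ((X ⅋ Y) ⅋ Z) [::].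
  by apply: step_shuffle; apply: ass_down.
apply: (step_trans0 (com _ _)); apply: (step_trans0 (ass _ _ _)).
apply: (step_trans0 (com _ _)); apply: (step_trans0 (ass _ _ _)).
exact: com.
Qed.

Lemma par_equiv_par A A' B B' :
  par_equiv A A' -> par_equiv B B' -> par_equiv (A ⅋ B) (A' ⅋ B').
Proof.
move=> [h1 h2] [h3 h4]; split.
  exact: step_trans0 (step_fill (ParL Hole B) h1) (step_fill (ParR A' Hole) h3).
exact: step_trans0 (step_fill (ParL Hole B') h2) (step_fill (ParR A Hole) h4).
Qed.

Lemma par_equiv_refl A : par_equiv A A.
Proof. by split; apply: step_refl. Qed.

Lemma pars_cat A G B D : par_equiv (pars A (G ++ B :: D)) (pars A G ⅋ pars B D).
Proof.
elim: G A => [|C G IH] A /=; first exact: par_equiv_refl.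
apply: par_equiv_trans (par_equivA _ _ _).
by apply: par_equiv_par => //; apply: par_equiv_refl.
Qed.

Lemma big_par_pars T A G : fringe T = A :: G -> par_equiv (big_par T) (pars A G).
Proof.
elim: T A G => [B|T1 IH1 T2 IH2] A G /=; first by case=> -> <-; apply: par_equiv_refl.
case e1: (fringe T1) => [|A1 G1]; first by case: (fringe_nil e1).
case e2: (fringe T2) => [|A2 G2]; first by case: (fringe_nil e2).
move=> [<- <-]; apply: par_equiv_trans (par_equiv_sym (pars_cat _ _ _ _)).
by apply: par_equiv_par; [apply: IH1|apply: IH2].
Qed.

Lemma pars_swap A B G : par_equiv (pars A (B :: G)) (pars B (A :: G)).
Proof.
case: G => [|C G]; first exact: par_equivC.
apply: par_equiv_trans (par_equivA _ _ _) _.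
apply: par_equiv_trans (par_equiv_sym (par_equivA _ _ _)).
by apply: par_equiv_par; [apply: par_equivC|apply: par_equiv_refl].
Qed.

Lemma pars_perm A G B D : perm_eq (A :: G) (B :: D) ->
  par_equiv (pars A G) (pars B D).
Proof.
have [n] := ubnP (size G); elim: n A G B D => // n IH A G B D sG p.
have sp := perm_size p.
have [[-> q]|[E [q1 q2]]] := perm_cons_cases p.
  case: G D sG sp q {p} => [|A' G] [|B' D] //= sG sp q; first exact: par_equiv_refl.
  by apply: par_equiv_par; [apply: par_equiv_refl|apply: IH].
have s1 := perm_size q1; have s2 := perm_size q2.
case: G sG sp s1 q1 {p} => [|A' G] //= sG [sp] [s1] q1.
case: D sp s2 q2 => [|B' D] //= [sp] [s2] q2.
(* The route is [A :: G], [A :: B :: E], [B :: A :: E], [B :: D]: a swap of heads between two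
   permutations of shorter lists. *)
apply: (@par_equiv_trans (pars A (B :: E))).
  by apply: par_equiv_par; [apply: par_equiv_refl|apply: IH].
apply: (par_equiv_trans (pars_swap _ _ _)).
apply: par_equiv_par; [exact: par_equiv_refl|apply: IH; last by rewrite perm_sym].
by rewrite -s1.
Qed.

Lemma step_pars A B G : step A B [::] -> step (pars A G) (pars B G) [::].
Proof. by case: G => [|C G] //= h; apply: (step_fill (ParL Hole (pars C G))). Qed.

(** One switch frees [D] from the tensor; a second one, between two commutations of the tensor,
    frees [G]. *)
Lemma step_tens_pars A G B D :
  step (pars A G ⊗ pars B D) (pars (A ⊗ B) (G ++ D)) [::].
Proof.
apply: (@step_trans0 (pars (pars A G ⊗ B) D)).
  case: D => [|C D]; first exact: step_refl.
  by apply: step_shuffle; apply: switch.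
apply: (@step_trans0 (pars (pars (A ⊗ B) G) D)).
  apply: step_pars; case: G => [|C G]; first exact: step_refl.
  apply: (@step_trans0 (B ⊗ pars A (C :: G))).
    by apply: step_shuffle; apply: com_up.
  apply: (@step_trans0 ((B ⊗ A) ⅋ pars C G)).
    by apply: step_shuffle; apply: switch.
  by apply: (step_fill (ParL Hole (pars C G))); apply: step_shuffle; apply: com_up.
case: D => [|C D]; first by rewrite cats0; apply: step_refl.
exact: (pars_cat _ _ _ _).2.
Qed.

(* The first component fails to be inductive at a tensor: there the proof of the
   left premise has to be replayed beside that of the right one, its first
   identity becoming a deep [i↓].  The second component does this. *)
Definition replayable A s : Prop :=
  cs_realizable A s /\ forall B, step B (A ⊗ B) s.

Lemma replayable_step A B s u :
  replayable A s -> step A B u -> replayable B (u ++ s).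
Proof.
move=> [h1 h2] h; split; first exact: (h Hole).
by move=> C; apply: step_trans (h2 C) (step_fill (TensL Hole C) h).
Qed.

Lemma replayable_perm A s t : perm_eq s t -> replayable A s -> replayable A t.
Proof.
move=> p [h1 h2]; split; first exact: cs_realizable_perm h1.
by move=> B K u /h2; apply: cs_realizable_perm; rewrite perm_cat2r.
Qed.

(** The proof of [A] is replayed beside the finished [B]. Beside a further [C], first [B] is
    replayed, then [A] next to [B ⊗ C], and the tensors are reassociated. *)
Lemma replayable_tens A B s t :
  replayable A s -> replayable B t -> replayable (A ⊗ B) (s ++ t).
Proof.
move=> [_ h2] [h3 h4]; split; first exact: (h2 B Hole).
move=> C; apply: (@step_trans (A ⊗ (B ⊗ C)) _ _ (s ++ t) [::]).
  exact: step_trans (h4 C) (h2 (B ⊗ C)).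
by apply: step_shuffle; apply: ass_up.
Qed.

Lemma der_replayable G s : der G s ->
  forall A G', G = A :: G' -> replayable (pars A G') s.
Proof.
elim=> {G s} [w w' ew l1 l2|A B G s _ IH|A B G D s t _ IH1 _ IH2
             |c G D s t _ IH1 _ IH2|G G' s s' pG ps _ IH] F H.
- move=> [<- <-] /=.
  have mL : mirror_links (Pos w) (Neg w') by move=> [|? ?] //= ? ? [<-] [<-].
  have eD : map_formula e (Pos w) = (map_formula e (Neg w'))^⊥ by rewrite /= ew.
  by split=> [|B]; [apply: cs_realizable_axiom|apply: step_idown].
- move=> [<- <-]; apply: (@replayable_step _ _ s [::]) (IH _ _ erefl) _.
  by case: G {IH} => [|C G]; [apply: step_refl|apply: (par_equivA _ _ _).1].
- move=> [<- <-].
  apply: (@replayable_step _ _ _ [::]) (@step_tens_pars A G B D).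
  exact: replayable_tens (IH1 _ _ erefl) (IH2 _ _ erefl).
(* A cut is a tensor at once removed by [i↑]. Since [G ++ D] is nonempty, the rule finds a par and
   its context-free form is avoided. *)
- move=> eE; apply: (@replayable_step _ _ (s ++ t) [:: c]) (@step_iup c _).
  apply: (@replayable_step _ _ _ [::]) (par_equivC _ _).1.
  have /(_ _ _ (@step_tens_pars _ G _ D)) := replayable_step
    (replayable_tens (IH1 _ _ erefl) (IH2 _ _ erefl)).
  by rewrite eE.
- move=> eG'; subst G'; apply: replayable_perm ps _.
  case: G pG IH => [|A G] pG IH; first by have := perm_size pG.
  exact: (@replayable_step _ _ s [::]) (IH _ _ erefl) (pars_perm pG).1.
Qed.

Lemma der_cs_net T U s : map_bracketing e U = T -> der (fringe U) s ->
  exists (d : cs_proof (Some (big_par T))) (f : cut (cs_net d) -> I),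
    @represents (cs_net d) (fringe U) f /\
    perm_eq (map f (enum (cut (cs_net d)))) s.
Proof.
move=> <-; case eU: (fringe U) => [|A G] dU; first by case: (fringe_nil eU).
have [h _] := der_replayable dU erefl.
have := (big_par_pars eU).2 Hole _ h.
move=> /cs_realizable_inv; rewrite -big_par_map => -[d [f [dec nam L ps]]].
exists d, f; split=> //; split; first by split; [rewrite -eU -fringe_map|exact: dec.2].
by rewrite -eU; apply/(links_push nam (@split_name U _ f)).
Qed.

(** The pars marked as commas are inverted one after the other; those inside the conclusions are
    left alone. *)
Lemma der_fringe U G s : der (big_par U :: G) s -> der (fringe U ++ G) s.
Proof.
elim: U G s => [//|U1 IH1 U2 IH2] G s /= /der_par_inv /IH1 d1.
rewrite -catA; apply: (@der_perm (fringe U2 ++ (fringe U1 ++ G)) _ s) => //.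
  by perm_solve.
by apply: IH2; apply: der_perm d1 => //; perm_solve.
Qed.

Lemma cs_net_der T U (d : cs_proof (Some (big_par T))) (f : cut (cs_net d) -> I) :
  map_bracketing e U = T -> @represents (cs_net d) (fringe U) f ->
  der (fringe U) (map f (enum (cut (cs_net d)))).
Proof.
move=> eT; subst T => -[[_ fE] L].
have dec : @decorates (cs_net1 d) [:: big_par U] f.
  by split; [rewrite cs_concl /= big_par_map|exact: fE].
have nam := preproof_named (cs_net1_preproof d) dec.
have rep := proj1 (links_push nam (@split_name U _ f)) L.
by have := der_fringe (cs_der (conj dec rep)); rewrite cats0.
Qed.

End Derivation.

(** * Labelling the leaves of a net by their addresses *)

Section Label.
Variables (V X : Type).

Fixpoint label (A : formula V) (f : Defs.path -> X) : formula X :=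
  match A with
  | Pos _ => Pos (f [::])
  | Neg _ => Neg (f [::])
  | B ⅋ C => label B (fun p => f (false :: p)) ⅋ label C (fun p => f (true :: p))
  | B ⊗ C => label B (fun p => f (false :: p)) ⊗ label C (fun p => f (true :: p))
  end.

Lemma leaf_at_label A f p :
  leaf_at (label A f) p = omap (fun l => (f p, l.2)) (leaf_at A p).
Proof.
by elim: A f p => [a|a|A IHA B IHB|A IHA B IHB] f [|[] p] //=; rewrite ?IHA ?IHB.
Qed.

Lemma map_label (e : X -> V) A f :
  (forall p a b, leaf_at A p = Some (a, b) -> e (f p) = a) ->
  map_formula e (label A f) = A.
Proof.
elim: A f => [a|a|A IHA B IHB|A IHA B IHB] f h /=.
- by rewrite (h [::] a true).
- by rewrite (h [::] a false).
- by rewrite (IHA _ (fun p => h (false :: p))) (IHB _ (fun p => h (true :: p))).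
- by rewrite (IHA _ (fun p => h (false :: p))) (IHB _ (fun p => h (true :: p))).
Qed.

End Label.

Fixpoint label_seq V J (n : nat) (G : seq (formula V)) : seq (formula (node J)) :=
  if G is A :: G' then label A (fun p => (inl n, p)) :: label_seq J n.+1 G'
  else [::].

Lemma onth_label_seq V J n (G : seq (formula V)) i :
  onth (label_seq J n G) i =
    omap (fun A => label A (fun p => (inl (n + i), p))) (onth G i).
Proof.
elim: G n i => [|A G IH] n [|i] //=; first by rewrite addn0.
by rewrite IH addnS.
Qed.

Lemma map_label_seq V J (e : node J -> V) n (G : seq (formula V)) :
  (forall i p a b, obind (fun A => leaf_at A p) (onth G i) = Some (a, b) ->
     e (inl (n + i), p) = a) ->
  map (map_formula e) (label_seq J n G) = G.
Proof.
elim: G n => [|A G IH] n h //=; rewrite IH => [|i p a b]; last first.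
  by rewrite addSnnS; apply: (h i.+1).
rewrite map_label // => p a b lp.
by have := h 0 p a b lp; rewrite addn0.
Qed.

(** * The net as its own labelling, and recovery of the net from the labels *)

Section Canonical.
Variables (V : Type) (N : linked_forest V) (a0 : V).

(* The default [a0] is only reached at nodes that are not leaves. *)
Definition atom_of (x : node (cut N)) : V :=
  if literal_of (concl N) (@cut_formula V N) x is Some (a, _) then a else a0.

Definition cut_labels (c : cut N) : formula (node (cut N)) * formula (node (cut N)) :=
  (label (cut_formula c) (fun p => (inr c, false :: p)),
   label (cut_formula c)^⊥ (fun p => (inr c, true :: p))).

Definition concl_labels := label_seq (cut N) 0 (concl N).

Lemma map_cut_labels1 c : map_formula atom_of (cut_labels c).1 = cut_formula c.
Proof. by rewrite map_label // => p a b lp; rewrite /atom_of /= lp. Qed.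

Lemma map_cut_labels2 c : map_formula atom_of (cut_labels c).2 = (cut_formula c)^⊥.
Proof. by rewrite map_label // => p a b lp; rewrite /atom_of /= lp. Qed.

Lemma map_concl_labels : map (map_formula atom_of) concl_labels = concl N.
Proof. by apply: map_label_seq => i p a b lp; rewrite /atom_of /= lp. Qed.

(** Labels are addresses, so looking one up returns the node itself, its cut renamed by [f]. Links
    between labels are therefore links of [N]. *)
Lemma canonical_name J (f : J -> cut N) x :
  name_at cut_labels concl_labels f x =
    omap (fun l => (rename_cut f x, l.2))
      (literal_of (concl N) (@cut_formula V N) (rename_cut f x)).
Proof.
case: x => [[i|c] p] /=.
  by rewrite onth_label_seq; case: onth => //= A; rewrite leaf_at_label.
by case: p => [|[] p] //=; rewrite leaf_at_label.
Qed.

Lemma canonical_represents :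
  represents atom_of cut_labels (@link V N) concl_labels (@id (cut N)).
Proof.
split; first by split=> [|c]; rewrite ?map_concl_labels ?map_cut_labels1.
move=> x y l m Rxy; rewrite !canonical_name.
have renE z : rename_cut (@id (cut N)) z = z by case: z => -[].
rewrite !renE; case: literal_of => //= lx [<-]; case: literal_of => //= ly [<-].
exact: Rxy.
Qed.

(** Listing every cut once makes [f] a bijection, and an inclusion between perfect matchings on the
    same leaves is an equality. *)
Lemma represents_same_net (M : linked_forest V) (f : cut M -> cut N) :
  preproof_net N -> preproof_net M ->
  represents atom_of cut_labels (@link V N) concl_labels f ->
  perm_eq (map f (enum (cut M))) (enum (cut N)) -> same_net M N.
Proof.
move=> [_ dN uN] [_ dM uM] [[cM fM] L] pf.
have fE c : cut_formula (f c) = cut_formula c by rewrite fM map_cut_labels1.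
have fI : injective f.
  by apply/injectiveP; rewrite /injectiveb /dinjectiveb (perm_uniq pf) enum_uniq.
have fB : bijective f.
  apply: inj_card_bij fI _.
  by rewrite !cardE -(perm_size pf) size_map.
rewrite map_concl_labels in cM.
have litE x : literal_of (concl N) (@cut_formula V N) (rename_cut f x) =
    literal_of (concl M) (@cut_formula V M) x.
  by case: x => -[i|c] [|[] p] /=; rewrite ?cM ?fE.
have LR x y : link x y -> link (rename_cut f x) (rename_cut f y).
  move=> Rxy; have [a [b [lx ly]]] := dM _ _ Rxy.
  have := L _ _ (rename_cut f x, b) (rename_cut f y, ~~ b) Rxy.
  by rewrite !canonical_name !litE lx ly; apply.
split=> //; exists f; split=> // x y; split; first exact: LR.
move=> Rxy; have [a [b [lx ly]]] := dN _ _ Rxy.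
(* The partner [z] of [x] in [M] is sent to a partner of the image of [x] in [N]; uniqueness there
   identifies it with the image of [y]. *)
have [|z [Rxz _]] := uM x; first by rewrite -litE lx.
have [|t [_ ut]] := uN (rename_cut f x); first by rewrite lx.
have : rename_cut f y = rename_cut f z.
  by rewrite -(ut _ Rxy) -(ut _ (LR _ _ Rxz)).
suff renI : injective (rename_cut f) by move=> /renI ->.
by move=> [[i|c] p] [[j|c'] q] //= [] => [-> ->|/fI -> ->].
Qed.

End Canonical.

(** There are no units, so every formula has a leaf; this provides the default of [atom_of]. *)
Lemma formula_atom V (A : formula V) : inhabited V.
Proof. by elim: A. Qed.

Theorem theorem2p35 (V : Type) (G : seq (formula V)) (T : bracketing V)
    (fringeT : fringe T = G) :
  (forall pi : sc_proof G, exists d : cs_proof (Some (big_par T)),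
     same_net (cs_net d) (sc_net pi)) /\
  (forall d : cs_proof (Some (big_par T)), exists pi : sc_proof G,
     same_net (sc_net pi) (cs_net d)).
Proof.
have [a0] := formula_atom (big_par T); split=> [pi|d].
  have cutE c : map_formula (atom_of a0) (cut_labels c).2 =
      (map_formula (atom_of a0) (@cut_labels V (sc_net pi) c).1)^⊥.
    by rewrite map_cut_labels1 map_cut_labels2.
  have [U [eU fU]] := @map_fringe_inv _ _ (atom_of a0) T (concl_labels (sc_net pi))
    (etrans (map_concl_labels _ a0) (etrans (sc_concl pi) (esym fringeT))).
  (* The net of [pi] represents itself. Passing through [der] gives a deep proof carrying the same
     labels and cuts. *)
  have := sc_der cutE (canonical_represents _ a0).
  rewrite -fU => /(der_cs_net cutE eU) [d [f [rep pf]]].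
  exists d; apply: (represents_same_net (f := f) (a0 := a0)).
  - exact: sc_net_preproof.
  - exact: cs_net_preproof.
  - by rewrite -fU.
  - by rewrite map_id in pf.
have cutE c : map_formula (atom_of a0) (cut_labels c).2 =
    (map_formula (atom_of a0) (@cut_labels V (cs_net d) c).1)^⊥.
  by rewrite map_cut_labels1 map_cut_labels2.
have [U [eU fU]] := @map_fringe_inv _ _ (atom_of a0) T (concl_labels (cs_net d))
  (map_concl_labels _ a0).
have := canonical_represents (cs_net d) a0.
rewrite -{1}fU => /(cs_net_der cutE eU) /(der_sc cutE) [G0 [pi [f [rep pf]]]].
(* The sequent found by [der_sc] is identified by erasing the labels of its conclusions. *)
have eG : G0 = G.
  by have := rep.1.1; rewrite sc_concl fU map_concl_labels /= fringeT.
subst G0; exists pi; apply: (represents_same_net (f := f) (a0 := a0)).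
- exact: cs_net_preproof.
- exact: sc_net_preproof.
- by rewrite -fU.
- by rewrite map_id in pf.
Qed.
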